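(* Let $0<a<b<\infty$, $\rho>0$, $\alpha>0$, and let $n\in\mathbb{N}$ be such that $\alpha\in(n-1,n)$. Let $x\in C^n[a,b]$ be a function. Then, for all $t\in[a,b]$, $$ {^C\mathcal{D}_{a+}^{\alpha,\rho}} x(t)=\mathcal{D}_{a+}^{\alpha,\rho} \left[x(t)-\sum_{k=0}^{n-1}\frac{\rho^{-k}}{k!}(t^\rho-a^\rho)^{k}x_{(k)}(a)\right]$$ and $$ {^C\mathcal{D}_{b-}^{\alpha,\rho}} x(t)=\mathcal{D}_{b-}^{\alpha,\rho} \left[x(t)-\sum_{k=0}^{n-1}\frac{\rho^{-k}(-1)^k}{k!}(b^\rho-t^\rho)^{k}x_{(k)}(b)\right].$$
   Context: $C^n[a,b]$ is the set of functions $x:[a,b]\to\mathbb{R}$ such that $x^{(n)}$ exists and is continuous on $[a,b]$ (derivatives at the endpoints are one-sided). Notation: $x_{(k)}(t):=\left(t^{1-\rho}\frac{d}{dt}\right)^k x(t)$ (so $x_{(0)}=x$). The left-sided and right-sided Caputo-Katugampola fractional derivatives of order $\alpha\in(n-1,n)$ and parameter $\rho$ are $${^C\mathcal{D}_{a+}^{\alpha,\rho}}x(t)=\frac{\rho^{1-n+\alpha}}{\Gamma(n-\alpha)}\int_a^t \tau^{\rho-1}(t^\rho-\tau^\rho)^{n-\alpha-1}\left(\tau^{1-\rho}\frac{d}{d\tau}\right)^n x(\tau)\, d\tau,$$ $${^C\mathcal{D}_{b-}^{\alpha,\rho}}x(t)=\frac{\rho^{1-n+\alpha}}{\Gamma(n-\alpha)}\int_t^b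 \tau^{\rho-1}(\tau^\rho-t^\rho)^{n-\alpha-1}\left(-\tau^{1-\rho}\frac{d}{d\tau}\right)^n x(\tau)\, d\tau.$$ The left-sided and right-sided Katugampola fractional derivatives of order $\alpha\in(n-1,n)$ and parameter $\rho$ are $$\mathcal{D}_{a+}^{\alpha,\rho}x(t)=\frac{\rho^{1-n+\alpha}}{\Gamma(n-\alpha)}\left(t^{1-\rho}\frac{d}{dt}\right)^n\int_a^t \tau^{\rho-1}(t^\rho-\tau^\rho)^{n-\alpha-1}x(\tau)\, d\tau,$$ $$\mathcal{D}_{b-}^{\alpha,\rho}x(t)=\frac{\rho^{1-n+\alpha}}{\Gamma(n-\alpha)}\left(-t^{1-\rho}\frac{d}{dt}\right)^n\int_t^b \tau^{\rho-1}(\tau^\rho-t^\rho)^{n-\alpha-1}x(\tau)\, d\tau.$$ In the claim, $\mathcal{D}_{a+}^{\alpha,\rho}[\,\cdot\,]$ and $\mathcal{D}_{b-}^{\alpha,\rho}[\,\cdot\,]$ act on the bracketed expression as a function of $t$, and the result is evaluated at $t$. *)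

(* Defs.v *)
From HB Require Import structures.
From mathcomp Require Export all_boot all_order all_algebra.
From mathcomp Require Export all_classical all_reals all_analysis.
Export Order.TTheory GRing.Theory Num.Theory.
Export numFieldNormedType.Exports.
Set Implicit Arguments.
Unset Strict Implicit.
Unset Printing Implicit Defensive.
Local Open Scope classical_set_scope.
Local Open Scope ring_scope.

Section Derivative.
Context {R : realType}.
Implicit Types (a b t : R) (f : R -> R).

(* Derivatives of functions on [a, b]: the difference quotient is restricted
   to [a, b], so the derivative is one-sided at the endpoints and values of f
   outside [a, b] play no role. *)
Definition derivable_on a b f t : Prop :=
  cvg ((f y - f t) / (y - t) @[y --> within `[a, b] t^']).

Definition deriv_on a b f t : R :=
  lim ((f y - f t) / (y - t) @[y --> within `[a, b] t^']).

(* The n-th iterate of a first-order differential operator D can be applied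
   to f: each function that gets differentiated is differentiable on all of
   [a, b]. *)
Definition iter_derivable a b (D : (R -> R) -> R -> R) (n : nat) f : Prop :=
  forall k, (k < n)%N ->
    forall t, t \in `[a, b] -> derivable_on a b (iter k D f) t.

Definition Cn_on a b (n : nat) f : Prop :=
  iter_derivable a b (deriv_on a b) n f /\
  {within `[a, b], continuous (iter n (deriv_on a b) f)}.

End Derivative.

Section FractionalDerivatives.
Context {R : realType}.
Implicit Types (a b rho alpha t tau : R) (n : nat) (x : R -> R).

Definition Gamma_fun (z : R) : R :=
  \int[lebesgue_measure]_(s in `]0, +oo[) (s `^ (z - 1) * expR (- s)).

Definition kdiff_left a b rho x t : R := t `^ (1 - rho) * deriv_on a b x t.

Definition kdiff_right a b rho x t : R := - t `^ (1 - rho) * deriv_on a b x t.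

Definition kernel_left rho alpha n t tau : R :=
  tau `^ (rho - 1) * (t `^ rho - tau `^ rho) `^ (n%:R - alpha - 1).

Definition kernel_right rho alpha n t tau : R :=
  tau `^ (rho - 1) * (tau `^ rho - t `^ rho) `^ (n%:R - alpha - 1).

Definition kcoef rho alpha n : R :=
  rho `^ (1 - n%:R + alpha) / Gamma_fun (n%:R - alpha).

Definition caputo_left a b rho alpha n x t : R :=
  kcoef rho alpha n *
  \int[lebesgue_measure]_(tau in `[a, t])
    (kernel_left rho alpha n t tau * iter n (kdiff_left a b rho) x tau).

Definition caputo_right a b rho alpha n x t : R :=
  kcoef rho alpha n *
  \int[lebesgue_measure]_(tau in `[t, b])
    (kernel_right rho alpha n t tau * iter n (kdiff_right a b rho) x tau).

Definition kint_left a rho alpha n x t : R :=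
  \int[lebesgue_measure]_(tau in `[a, t])
    (kernel_left rho alpha n t tau * x tau).

Definition kint_right b rho alpha n x t : R :=
  \int[lebesgue_measure]_(tau in `[t, b])
    (kernel_right rho alpha n t tau * x tau).

Definition katugampola_left a b rho alpha n x t : R :=
  kcoef rho alpha n *
  iter n (kdiff_left a b rho) (kint_left a rho alpha n x) t.

Definition katugampola_right a b rho alpha n x t : R :=
  kcoef rho alpha n *
  iter n (kdiff_right a b rho) (kint_right b rho alpha n x) t.

(* The four operators above are total functions (limits and integrals have
   default values). The predicates below say that all the derivatives and
   integrals involved genuinely exist on [a, b]. *)
Definition kint_left_defined a b rho alpha n x : Prop :=
  forall t, t \in `[a, b] ->
    lebesgue_measure.-integrable `[a, t]
      (fun tau => (kernel_left rho alpha n t tau * x tau)%:E).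

Definition kint_right_defined a b rho alpha n x : Prop :=
  forall t, t \in `[a, b] ->
    lebesgue_measure.-integrable `[t, b]
      (fun tau => (kernel_right rho alpha n t tau * x tau)%:E).

Definition caputo_left_defined a b rho alpha n x : Prop :=
  iter_derivable a b (kdiff_left a b rho) n x /\
  kint_left_defined a b rho alpha n (iter n (kdiff_left a b rho) x).

Definition caputo_right_defined a b rho alpha n x : Prop :=
  iter_derivable a b (kdiff_right a b rho) n x /\
  kint_right_defined a b rho alpha n (iter n (kdiff_right a b rho) x).

Definition katugampola_left_defined a b rho alpha n x : Prop :=
  kint_left_defined a b rho alpha n x /\
  iter_derivable a b (kdiff_left a b rho) n (kint_left a rho alpha n x).

Definition katugampola_right_defined a b rho alpha n x : Prop :=
  kint_right_defined a b rho alpha n x /\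
  iter_derivable a b (kdiff_right a b rho) n (kint_right b rho alpha n x).

(* In both remainders x_(k) is the iterate of the unsigned operator
   t^(1-rho) d/dt; the sign at b is the explicit (-1)^k. *)
Definition remainder_left a b rho n x t : R :=
  x t - \sum_(k < n) rho ^- k / k`!%:R * (t `^ rho - a `^ rho) ^+ k
          * iter k (kdiff_left a b rho) x a.

Definition remainder_right a b rho n x t : R :=
  x t - \sum_(k < n) rho ^- k * (-1) ^+ k / k`!%:R
          * (b `^ rho - t `^ rho) ^+ k * iter k (kdiff_left a b rho) x b.

End FractionalDerivatives.

(* Main.v *)
Require Import Defs.
From mathcomp Require Import measurable_realfun ring lra.
Set Implicit Arguments.
Unset Strict Implicit.
Unset Printing Implicit Defensive.
Local Open Scope classical_set_scope.
Local Open Scope ring_scope.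

(** Write e = n - alpha - 1, so that -1 < e.  The variable u = t^rho (left
case) or u = - t^rho (right case), measured from its value A at the base point
a, respectively b, turns the operator +-t^(1-rho) d/dt into rho d/du and the
kernel tau^(rho-1) |t^rho - tau^rho|^e dtau into rho^-1 v^e dv, where v is the
distance travelled in u.  Up to powers of rho that cancel, both identities
therefore become one statement about the Riemann-Liouville integral
K F (s) = int_0^(s-A) v^e F(s-v) dv, namely (K Rem)^(n) = K (X^(n)), where X is
x read in the variable u and Rem is X minus its Taylor polynomial of degree
n - 1 at A.

The heart is one differentiation step, [riemann_liouville_deriv]: if F is C^1
on [A, B] and F(A) = 0, then (K F)' = K F' on [A, B], with one-sided
derivatives at the ends.  Moving the derivative inside is impeded by the
moving end point s - A and by the end points A and B.  Both obstacles vanish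
after extending F to the line by the constants F(A) = 0 and F(B): the integral
then runs over the fixed segment [0, B - A], and the extension is Lipschitz and
differentiable off the two points A and B, so that v^e times a difference
quotient of F is dominated by a multiple of the integrable function v^e
([convolution_derivative]).  Since the derivative of a Taylor remainder is the
Taylor remainder of the derivative, and all of them up to order n - 1 vanish at
A, the step iterates n times ([riemann_liouville_taylor_rem]).

Two more ingredients connect this with the stated operators.  The change of
variable has an integrand that is unbounded at tau = t; it is obtained as a
monotone limit of changes of variable on segments that avoid this point
([left_substitution], [right_substitution]).  And x being C^n for the ordinary
derivative has to give n derivatives for t^(1-rho) d/dt: by homogeneity the
k-th iterate is a combination of the t^(j - k rho) x^(j)(t) with j <= k
([Cn_on_iter]).  [remainder_transport] assembles everything for both signs at
once. *)

(** * One-sided derivatives on a segment *)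

Section OneSidedDerivative.
Context {R : realType}.
Implicit Types (a b t l c : R) (f g : R -> R).

Definition is_deriv_on a b f t l : Prop :=
  (f y - f t) / (y - t) @[y --> within `[a, b] t^'] --> l.

(** Properness makes limits of difference quotients unique also at the two end
points, where only one side of the punctured neighbourhood is left. *)
Lemma within_dnbhs_proper a b t : a < b -> t \in `[a, b] ->
  ProperFilter (within `[a, b] t^').
Proof.
move=> ab tab; apply: Build_ProperFilter => //.
move=> /nbhs_ballP[e /= e0 he].
move: tab; rewrite in_itv/= => /andP[at_ tb].
have [tb'|bt] := ltP t b.
  have m0 : 0 < Num.min (e / 2) (b - t).
    by rewrite lt_min divr_gt0//= subr_gt0.
  have m1 : Num.min (e / 2) (b - t) <= e / 2 by rewrite ge_min lexx.
  have m2 : Num.min (e / 2) (b - t) <= b - t by rewrite ge_min lexx orbT.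
  move: (Num.min _ _) m0 m1 m2 => m m0 m1 m2.
  apply: (he (t + m)).
  - rewrite /ball/= opprD addNKr normrN gtr0_norm//; lra.
  - by rewrite gt_eqF// ltrDl.
  - rewrite /= in_itv/=; lra.
have m0 : 0 < Num.min (e / 2) (b - a).
  by rewrite lt_min divr_gt0//= subr_gt0.
have m1 : Num.min (e / 2) (b - a) <= e / 2 by rewrite ge_min lexx.
have m2 : Num.min (e / 2) (b - a) <= b - a by rewrite ge_min lexx orbT.
move: (Num.min _ _) m0 m1 m2 => m m0 m1 m2.
apply: (he (t - m)).
- rewrite /ball/= opprB addrC subrK gtr0_norm//; lra.
- by rewrite lt_eqF// ltrBlDr ltrDl.
- rewrite /= in_itv/=; lra.
Qed.

Lemma near_within_dnbhs a b t (P : R -> Prop) :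
  (forall y, y != t -> y \in `[a, b] -> P y) ->
  \forall y \near within `[a, b] t^', P y.
Proof.
move=> h; have : nbhs t (fun y => y != t -> y \in `[a, b] -> P y).
  by apply: filterE => y yt yab; exact: h.
exact.
Qed.

Lemma cvg_within_dnbhs a b t : y @[y --> within `[a, b] t^'] --> t.
Proof. by apply: cvg_within_filter; exact: cvg_within. Qed.

Lemma is_deriv_on_derivable a b f t l :
  is_deriv_on a b f t l -> derivable_on a b f t.
Proof. by move=> fl; apply/cvg_ex; exists l. Qed.

Lemma is_deriv_onE a b f t l : a < b -> t \in `[a, b] ->
  is_deriv_on a b f t l -> deriv_on a b f t = l.
Proof.
move=> ab tab fl; have := within_dnbhs_proper ab tab => P.
exact: cvg_lim.
Qed.

Lemma eq_is_deriv_on a b f g t l : t \in `[a, b] -> {in `[a, b], f =1 g} ->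
  is_deriv_on a b f t l -> is_deriv_on a b g t l.
Proof.
move=> tab fg; apply: cvg_trans; apply: near_eq_cvg.
by apply: near_within_dnbhs => y _ yab; rewrite !fg.
Qed.

Lemma is_deriv_on_cvg a b f t l : is_deriv_on a b f t l ->
  f y @[y --> within `[a, b] t^'] --> f t.
Proof.
move=> fl; have e : f t = l * (t - t) + f t by rewrite subrr mulr0 add0r.
rewrite [X in _ --> X]e.
refine (cvg_trans _ (cvgD (cvgM fl (cvgB (@cvg_within_dnbhs a b t) (cvg_cst t)))
             (cvg_cst (f t)))); apply: near_eq_cvg.
apply: near_within_dnbhs => y yt _ /=.
by rewrite ?fctE /= divfK ?subr_eq0// subrK.
Qed.

Lemma is_deriv_on_continuous a b f :
  (forall t, t \in `[a, b] -> exists l, is_deriv_on a b f t l) ->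
  {within `[a, b], continuous f}.
Proof.
move=> fd; apply/subspace_continuousP => t tab.
have [l /is_deriv_on_cvg fl] := fd _ tab.
apply/cvgrPdist_le => e e0.
move/cvgrPdist_le : fl => /(_ _ e0) /nbhs_ballP[d /= d0 h].
suff : nbhs (t : R) (fun y : R => y \in `[a, b] -> `|f t - f y| <= e) by [].
apply/nbhs_normP; exists d => //= y yd yab.
have [->|yt] := eqVneq y t; first by rewrite subrr normr0 ltW.
exact: h.
Qed.

Lemma is_deriveP f t l : is_derive t 1 f l ->
  (f y - f t) / (y - t) @[y --> t^'] --> l.
Proof.
move=> [/cvg_ex[m fm] dl]; have ml : m = l by rewrite -dl; apply/esym/cvg_lim.
rewrite {}ml {dl} in fm.
apply/cvgrPdist_le => e e0.
move/cvgrPdist_le : fm => /(_ _ e0) /nbhs_ballP[d /= d0 h].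
suff : nbhs t (fun y => y != t -> `|l - (f y - f t) / (y - t)| <= e) by [].
apply/nbhs_normP; exists d => //= y yd yt.
have := h (y - t); rewrite /ball/= sub0r normrN distrC scaler1 subrK.
by rewrite /GRing.scale/= [_^-1 * _]mulrC; apply; rewrite ?subr_eq0.
Qed.

Lemma is_derive_on a b f t l : is_derive t 1 f l -> is_deriv_on a b f t l.
Proof. by move=> /is_deriveP; exact: cvg_within_filter. Qed.

Lemma is_deriv_on_interior a b f t l : t \in `]a, b[ ->
  is_deriv_on a b f t l -> is_derive t 1 f l.
Proof.
rewrite in_itv/= => /andP[at_ tb] fl.
have : h^-1 *: (f (h *: 1 + t) - f t) @[h --> 0^'] --> l.
  apply/cvgrPdist_le => e e0.
  move/cvgrPdist_le : fl => /(_ _ e0) /nbhs_ballP[d /= d0 h].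
  have m0 : 0 < Num.min d (Num.min (b - t) (t - a)).
    by rewrite !lt_min d0 !subr_gt0 at_ tb.
  suff : nbhs (0 : R) (fun y : R => y != 0 ->
      `|l - y^-1 *: (f (y *: 1 + t) - f t)| <= e) by [].
  apply/nbhs_normP; exists (Num.min d (Num.min (b - t) (t - a))) => //= y.
  rewrite /ball/= sub0r normrN !lt_min => /and3P[yd yb ya] y0.
  have := h (y + t); rewrite /ball/= scaler1 addrK opprD addrCA subrr addr0.
  rewrite normrN yd /GRing.scale/= [_^-1 * _]mulrC; apply => //.
    by rewrite -subr_eq0 addrK.
  rewrite in_itv/=; move: yb ya; rewrite !ltr_norml => /andP[? ?] /andP[? ?].
  by apply/andP; split; lra.
move=> fl'; have dl : 'D_1 f t = l by apply: cvg_lim => //.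
by rewrite -dl; apply: DeriveDef => //; apply/cvg_ex; exists l.
Qed.

Lemma is_deriv_on_cst a b c t : is_deriv_on a b (cst c) t 0.
Proof. by apply: is_derive_on; exact: is_derive_cst. Qed.

Lemma is_deriv_onD a b f g t l m : is_deriv_on a b f t l ->
  is_deriv_on a b g t m -> is_deriv_on a b (fun y => f y + g y) t (l + m).
Proof.
move=> fl gm; refine (cvg_trans _ (cvgD fl gm)); apply: near_eq_cvg.
by apply: nearW => y; rewrite -mulrDl opprD addrACA.
Qed.

Lemma is_deriv_onZ a b c f t l : is_deriv_on a b f t l ->
  is_deriv_on a b (fun y => c * f y) t (c * l).
Proof.
move=> fl; refine (cvg_trans _ (cvgM (cvg_cst c) fl)); apply: near_eq_cvg.
by apply: nearW => y; rewrite ?fctE /= mulrA mulrBr.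
Qed.

Lemma is_deriv_onB a b f g t l m : is_deriv_on a b f t l ->
  is_deriv_on a b g t m -> is_deriv_on a b (fun y => f y - g y) t (l - m).
Proof.
move=> fl gm; refine (cvg_trans _ (cvgB fl gm)); apply: near_eq_cvg.
by apply: nearW => y; rewrite ?fctE /= -mulrBl !opprD opprK addrACA.
Qed.

Lemma is_deriv_onM a b f g t l m : is_deriv_on a b f t l ->
  is_deriv_on a b g t m ->
  is_deriv_on a b (fun y => f y * g y) t (l * g t + f t * m).
Proof.
move=> fl gm.
refine (cvg_trans _
  (cvgD (cvgM fl (cvg_cst (g t))) (cvgM (is_deriv_on_cvg fl) gm))).
apply: near_eq_cvg.
by apply: nearW => y; rewrite ?fctE /=; ring.
Qed.

Lemma is_deriv_on_sum a b n (F : nat -> R -> R) t (l : nat -> R) :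
  (forall j, (j < n)%N -> is_deriv_on a b (F j) t (l j)) ->
  is_deriv_on a b (fun y => \sum_(j < n) F j y) t (\sum_(j < n) l j).
Proof.
elim: n => [|n IHn] h.
  rewrite big_ord0; under eq_fun do rewrite big_ord0.
  exact: is_deriv_on_cst.
rewrite big_ord_recr/=; under eq_fun do rewrite big_ord_recr/=.
by apply: is_deriv_onD; [apply: IHn => j jn; apply: h; rewrite ltnW|exact: h].
Qed.

(** Injectivity of [phi] keeps [phi y - phi t] nonzero, so the difference
quotient of the composite is literally a product of two difference quotients. *)
Lemma is_deriv_on_comp a b A B phi f t l m : t \in `[a, b] ->
  {in `[a, b], forall y, phi y \in `[A, B]} ->
  {in `[a, b] &, injective phi} ->
  is_deriv_on a b phi t m -> is_deriv_on A B f (phi t) l ->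
  is_deriv_on a b (f \o phi) t (l * m).
Proof.
move=> tab phiAB phi_inj phim fl.
have phi_cvg : phi y @[y --> within `[a, b] t^'] --> within `[A, B] (phi t)^'.
  move=> P /nbhs_ballP[d /= d0 h].
  have /cvgrPdist_lt/(_ _ d0) := is_deriv_on_cvg phim.
  have : \forall y \near within `[a, b] t^', y != t /\ y \in `[a, b].
    by apply: near_within_dnbhs => y yt yab; split.
  apply: filterS2 => y [yt yab] phid; apply: h => //; last exact: phiAB.
  by apply: contra_neq yt => /phi_inj; apply.
refine (cvg_trans _ (cvgM (cvg_comp _ _ phi_cvg fl) phim)); apply: near_eq_cvg.
apply: near_within_dnbhs => y yt yab; rewrite ?fctE /= mulrA divfK// subr_eq0.
by apply: contra_neq yt => /phi_inj; apply.
Qed.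

(** The iterates of the operator [w d/dt] are only meaningful on [a, b], and
outside it they take default values.  A chain records candidates [g 0], [g 1],
... for these iterates by formulas, so that differentiability and the value of
the iterates can be read off together. *)
Definition op_chain a b (w : R -> R) n (g : nat -> R -> R) : Prop :=
  forall k t, (k < n)%N -> t \in `[a, b] ->
    exists2 l, is_deriv_on a b (g k) t l & g k.+1 t = w t * l.

Lemma op_chain_iter a b w n (g : nat -> R -> R) (D : (R -> R) -> R -> R) f :
  a < b -> (forall h t, D h t = w t * deriv_on a b h t) ->
  op_chain a b w n g -> {in `[a, b], f =1 g 0%N} ->
  iter_derivable a b D n f /\
  forall k, (k <= n)%N -> {in `[a, b], iter k D f =1 g k}.
Proof.
move=> ab DE gch fg0.
have DfE k : (k <= n)%N -> {in `[a, b], iter k D f =1 g k}.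
  elim: k => [_|k IHk kn t tab]; first exact: fg0.
  have [l gl ->] := gch k t kn tab.
  rewrite iterS DE (is_deriv_onE (l := l))//.
  apply: eq_is_deriv_on gl => // y yab.
  by rewrite IHk// ltnW.
split=> // k kn t tab; have [l gl _] := gch k t kn tab.
apply: (@is_deriv_on_derivable _ _ _ _ l).
by apply: eq_is_deriv_on gl => // y yab; rewrite DfE// ltnW.
Qed.

Lemma iter_op_chain a b w n (D : (R -> R) -> R -> R) f :
  (forall h t, D h t = w t * deriv_on a b h t) ->
  iter_derivable a b D n f -> op_chain a b w n (fun k => iter k D f).
Proof.
move=> DE fD k t kn tab; exists (deriv_on a b (iter k D f) t); last exact: DE.
exact: fD.
Qed.

End OneSidedDerivative.

(** * Exhausting a segment from one end *)

Section Exhaustion.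
Context {R : realType}.
Implicit Types (a b : R) (f : R -> R) (u : R^nat).
Notation mu := (@lebesgue_measure R).

Lemma ge0_integral_exhaust_right a b f u :
  measurable_fun `[a, b] f -> {in `[a, b], forall x, 0 <= f x} ->
  nondecreasing_seq u -> (forall n, u n < b) -> u n @[n --> \oo] --> b ->
  (\int[mu]_(x in `[a, u n]) (f x)%:E @[n --> \oo] -->
   \int[mu]_(x in `[a, b]) (f x)%:E)%E.
Proof.
move=> mf f0 und ub ucvg.
have sub n : `[a, u n] `<=` `[a, b].
  by apply: subset_itvl; rewrite bnd_simp ltW.
have -> : (\int[mu]_(x in `[a, b]) (f x)%:E =
    \int[mu]_(x in \bigcup_n `[a, u n]%classic) (f x)%:E)%E.
  rewrite -integral_itv_bndo_bndc; last first.
    apply/measurable_EFinP; apply: measurable_funS mf => //.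
    by apply: subset_itvl; rewrite bnd_simp.
  congr (integral _ _ _); apply/seteqP; split => x /=.
    rewrite in_itv/= => /andP[ax xb].
    have [n _ /(_ n (leqnn n)) h] : \forall n \near \oo, x < u n.
      by move/cvgr_gt : ucvg; apply.
    by exists n => //=; rewrite in_itv/= ax ltW.
  move=> [n _ /=]; rewrite !in_itv/= => /andP[-> xu].
  exact: le_lt_trans (ub n).
apply: ge0_nondecreasing_set_cvg_integral => //.
- move=> m n mn; rewrite subsetEset.
  by apply: subset_itvl; rewrite bnd_simp und.
- by move=> n; apply/measurable_EFinP; apply: measurable_funS (sub n) mf.
- by move=> n x /sub xab; rewrite lee_fin f0.
Qed.

Lemma ge0_integral_exhaust_left a b f u :
  measurable_fun `[a, b] f -> {in `[a, b], forall x, 0 <= f x} ->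
  nonincreasing_seq u -> (forall n, a < u n) -> u n @[n --> \oo] --> a ->
  (\int[mu]_(x in `[u n, b]) (f x)%:E @[n --> \oo] -->
   \int[mu]_(x in `[a, b]) (f x)%:E)%E.
Proof.
move=> mf f0 und ub ucvg.
have sub n : `[u n, b] `<=` `[a, b].
  by apply: subset_itvr; rewrite bnd_simp ltW.
have -> : (\int[mu]_(x in `[a, b]) (f x)%:E =
    \int[mu]_(x in \bigcup_n `[u n, b]%classic) (f x)%:E)%E.
  rewrite -integral_itv_obnd_cbnd; last first.
    apply/measurable_EFinP; apply: measurable_funS mf => //.
    by apply: subset_itvr; rewrite bnd_simp.
  congr (integral _ _ _); apply/seteqP; split => x /=.
    rewrite in_itv/= => /andP[ax xb].
    have [n _ /(_ n (leqnn n)) h] : \forall n \near \oo, u n < x.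
      by move/cvgr_lt : ucvg; apply.
    by exists n => //=; rewrite in_itv/= xb ltW.
  move=> [n _ /=]; rewrite !in_itv/= => /andP[xu ->].
  by rewrite andbT (lt_le_trans (ub n)).
apply: ge0_nondecreasing_set_cvg_integral => //.
- move=> m n mn; rewrite subsetEset.
  by apply: subset_itvr; rewrite bnd_simp und.
- by move=> n; apply/measurable_EFinP; apply: measurable_funS (sub n) mf.
- by move=> n x /sub xab; rewrite lee_fin f0.
Qed.

End Exhaustion.

Section PowerKernel.
Context {R : realType}.
Implicit Types (L e a b : R).
Notation mu := (@lebesgue_measure R).

Lemma derivable_cc_LRcontinuous (f : R -> R) a b : a < b ->
  {in `[a, b], forall x, derivable f x 1} -> derivable_oo_LRcontinuous f a b.
Proof.
move=> ab fd; have /(continuous_within_itvP _ ab)[_ fa fb] :=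
  derivable_within_continuous fd.
by split => // x /subset_itv_oo_cc /fd.
Qed.

Lemma is_derive_powRD1 e (x : R) : 0 < e + 1 -> 0 < x ->
  is_derive x 1 (fun x => x `^ (e + 1) / (e + 1)) (x `^ e).
Proof.
move=> e1 x0.
have d := is_derive1_powR (e + 1) x0.
rewrite (_ : (fun _ => _) = (e + 1)^-1 \*: (fun y : R => y `^ (e + 1))).
  by apply: is_derive_eq; rewrite addrK /GRing.scale/= mulKf// gt_eqF.
by apply/funext => y; rewrite /= mulrC.
Qed.

(** The integrals over the segments [L/(n+2), L] are computed with the
primitive v^(e+1)/(e+1) and stay below its value at L, as [0 < e + 1]. *)
Lemma powR_integrable L e : 0 < e + 1 ->
  mu.-integrable `[0, L] (fun v => (v `^ e)%:E).
Proof.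
move=> e1; wlog L0 : L / 0 < L.
  move=> h; apply: (@integrableS _ _ _ mu `[0, Num.max L 1]%classic) => //.
    by apply: subset_itvl; rewrite bnd_simp le_max lexx.
  by apply: h; rewrite lt_max ltr01 orbT.
have mp : measurable_fun `[0, L] (fun v : R => v `^ e).

  by apply: measurable_funTS; exact: measurable_powR.
apply/integrableP; split; first exact/measurable_EFinP.
under eq_integral do rewrite /= ger0_norm ?powR_ge0//.
pose f (v : R) := v `^ e.
pose u (n : nat) := L * n.+2%:R^-1.
have u0 n : 0 < u n by rewrite mulr_gt0// invr_gt0.
have uL n : u n < L.
  by rewrite /u gtr_pMr// invf_lt1// ltr1n.
have H : (\int[mu]_(x in `[u n, L]%classic) (f x)%:E @[n --> \oo] -->
   \int[mu]_(x in `[0%R, L]%classic) (f x)%:E)%E.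
  apply: ge0_integral_exhaust_left => //.
  - by move=> x _; rewrite powR_ge0.
  - by move=> m n mn; rewrite ler_pM2l// lef_pV2 ?posrE// ler_nat.
  - rewrite -[X in _ --> X](mulr0 L); apply: cvgM; first exact: cvg_cst.
    have := @cvg_harmonic R; rewrite -(cvg_shiftS); exact.
apply: (@le_lt_trans _ _ (L `^ (e + 1) / (e + 1))%:E); last exact: ltry.
rewrite -(cvg_lim _ H)//; apply: lime_le.
  by apply/cvg_ex; eexists; exact: H.
apply: nearW => n.
rewrite (@continuous_FTC2 _ _ (fun x => x `^ (e + 1) / (e + 1)))//.
- rewrite -EFinB lee_fin gerBl mulr_ge0// ?powR_ge0// invr_ge0 ltW//.
- apply: derivable_within_continuous => x; rewrite in_itv/= => /andP[ux _].
  by apply: derivable_powR; rewrite in_itv/= andbT (lt_le_trans _ ux).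
- apply: derivable_cc_LRcontinuous => // x; rewrite in_itv/= => /andP[ux _].
  by have [] := is_derive_powRD1 e1 (lt_le_trans (u0 n) ux).
- move=> x; rewrite in_itv/= => /andP[ux _]; rewrite derive1E.
  by have [_ ->] := is_derive_powRD1 e1 (lt_trans (u0 n) ux).
Qed.

End PowerKernel.

(** * Differentiating a convolution with an integrable kernel *)

Section Convolution.
Context {R : realType}.
Implicit Types (A B L M s u : R) (k F G H dH : R -> R).
Notation mu := (@lebesgue_measure R).

Lemma lipschitz_continuous H M : (forall x y, `|H x - H y| <= M * `|x - y|) ->
  continuous H.
Proof.
move=> HM x; apply/cvgrPdist_le => e e0.
have M1 : 0 < `|M| + 1 by rewrite ltr_pwDr.
near=> y.
rewrite (le_trans (HM _ _))// (@le_trans _ _ ((`|M| + 1) * `|x - y|))//.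
  by rewrite ler_wpM2r// (le_trans (ler_norm M))// lerDl.
rewrite mulrC -ler_pdivlMr// ltW//.
near: y; apply: cvgr_dist_lt => //; exact: divr_gt0.
Unshelve. all: end_near. Qed.

Lemma integrable_kernelM (D : set R) k H M : measurable D ->
  mu.-integrable D (EFin \o k) ->
  measurable_fun D H -> (forall x, D x -> `|H x| <= M) ->
  mu.-integrable D (EFin \o (fun v => k v * H v)).
Proof.
move=> mD ik mH HM.
have mk : measurable_fun D k by move/integrableP : ik => [/measurable_EFinP].
have : mu.-integrable D (fun v => (M%:E * (k v)%:E)%E).
  exact: integrableZl.
apply: le_integrable => //.
- by apply/measurable_EFinP; exact: measurable_funM.
- move=> x Dx; rewrite lee_fin !normrM mulrC ler_wpM2r//.
  by rewrite (le_trans (HM _ Dx))// ler_norm.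
Qed.

(** Dominated convergence along sequences [u n --> s]: the difference quotients
of [H] are bounded by the Lipschitz constant, and they converge for all [v]
except [s - A] and [s - B].  Only the function [H] is shifted, never the kernel
[k], so a singularity of [k] does no harm. *)
Lemma convolution_derivative k H dH M L A B s :
  mu.-integrable `[0, L] (EFin \o k) ->
  (forall x y, `|H x - H y| <= M * `|x - y|) ->
  (forall u, u != A -> u != B ->
    (H y - H u) / (y - u) @[y --> u^'] --> dH u) ->
  measurable_fun setT dH ->
  let Phi y := \int[mu]_(v in `[0, L]) (k v * H (y - v)) in
  (Phi y - Phi s) / (y - s) @[y --> s^'] -->
    \int[mu]_(v in `[0, L]) (k v * dH (s - v)).
Proof.
move=> ik HM HdH mdH Phi.
have cH := lipschitz_continuous HM.
have mk : measurable_fun `[0, L] k.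
  by move/integrableP : ik => [/measurable_EFinP].
have mB y : measurable_fun `[0, L] (fun v : R => y - v).
  exact: measurable_funB.
have mHs y : measurable_fun `[0, L] (fun v : R => H (y - v)).
  apply: measurableT_comp => //.
  exact: continuous_measurable_fun.
have ikH y : mu.-integrable `[0, L] (EFin \o (fun v => k v * H (y - v))).
  apply: (@integrable_kernelM _ _ _ (`|H y| + `|M| * L)) => //.
  move=> v /=; rewrite in_itv/= => /andP[v0 vL].
  rewrite -[X in `|X|](subrK (H y)) (le_trans (ler_normD _ _))// addrC lerD//.
  rewrite (le_trans (HM _ _))// addrAC subrr add0r normrN ger0_norm//.
  by rewrite (@le_trans _ _ (`|M| * v)) ?ler_wpM2r ?ler_norm// ler_wpM2l.
apply/cvgr_dnbhsP => u [us ucvg].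
pose f_ n v := k v * ((H (u n - v) - H (s - v)) / (u n - s)).
have PhiE n : (Phi (u n) - Phi s) / (u n - s) =
    \int[mu]_(v in `[0, L]) f_ n v.
  rewrite -RintegralB// -RintegralZr//.
    by apply: eq_Rintegral => v _; rewrite /f_ -mulrBr mulrA.
  exact: (integrableB _ (ikH _) (ikH _)).
under eq_cvg do rewrite PhiE.
have [||||||H1 _ H3] := @dominated_convergence _ _ R mu `[0, L]%classic _
  (fun n v => (f_ n v)%:E) (fun v => (k v * dH (s - v))%:E)
  (fun v => (`|M|%:E * `|(k v)%:E|)%E) => //.
- move=> n; apply/measurable_EFinP; rewrite /f_; apply: measurable_funM => //.
  by apply: measurable_funM => //; apply: measurable_funB; exact: mHs.
- apply/measurable_EFinP; apply: measurable_funM => //.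
  by apply: measurableT_comp => //; exact: mB.
- exists [set s - A; s - B]; split => //.
  + by apply: measurableU.
  + by apply: countable_lebesgue_measure0; apply: finite_set_countable.
  + move=> v /= Pv; apply: contrapT => /not_orP[vA vB]; apply: Pv => _.
    apply: cvg_EFin; first by near=> n.
    apply: cvgM; first exact: cvg_cst.
    have sA : s - v != A by apply: contra_notN vA => /eqP <-; rewrite subKr.
    have sB : s - v != B by apply: contra_notN vB => /eqP <-; rewrite subKr.
    have /cvgr_dnbhsP/(_ (fun n => u n - v)) := HdH _ sA sB.
    have uv : (forall n, u n - v != s - v) /\ u n - v @[n --> \oo] --> s - v.
      split; first by move=> n; rewrite (inj_eq (addIr _)).
      by apply: cvgB => //; exact: cvg_cst.
    move=> /(_ uv); apply: cvg_trans; apply: near_eq_cvg.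
    by apply: nearW => n /=; rewrite opprB addrA subrK.
- apply: integrableZl => //; exact: integrable_abse.
- apply: aeW => /= v n _; rewrite lee_fin /f_ normrM mulrC ler_wpM2r//.
  rewrite normrM normfV ler_pdivrMr ?normr_gt0 ?subr_eq0//.
  by rewrite (le_trans (HM _ _))// opprB addrA subrK ler_wpM2r// ler_norm.
have ifin := integrable_fin_num _ H1.
by move: H3; rewrite -(fineK (ifin _)) => // /fine_cvg.
Unshelve. all: end_near.
Qed.

End Convolution.

(** * The Riemann-Liouville integral and its derivative *)

Section RiemannLiouville.
Context {R : realType}.
Implicit Types (A B e s u : R) (F G H : R -> R).
Notation mu := (@lebesgue_measure R).

Definition riemann_liouville A e F s : R :=
  \int[mu]_(v in `[0, s - A]) (v `^ e * F (s - v)).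

Lemma within_continuous_bounded A B G : {within `[A, B], continuous G} ->
  exists2 M, 0 <= M & {in `[A, B], forall u, `|G u| <= M}.
Proof.
move=> cG.
have /compact_bounded[M [_ hM]] :=
  continuous_compact cG (@segment_compact _ A B).
exists (`|M| + 1); first by rewrite addr_ge0.
move=> u uAB; apply: hM; last by exists u.
by rewrite (le_lt_trans (ler_norm M))// ltrDl.
Qed.

(** Mean value theorem between the two points; the one-sided derivatives at [A]
and [B] enter only through continuity there. *)
Lemma deriv_on_lipschitz A B F G M : A < B ->
  (forall u, u \in `[A, B] -> is_deriv_on A B F u (G u)) ->
  {in `[A, B], forall u, `|G u| <= M} ->
  {in `[A, B] &, forall x y, `|F x - F y| <= M * `|x - y|}.
Proof.
move=> AB FG GM x y xAB yAB.
wlog xy : x y xAB yAB / x <= y.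
  move=> h; have [|/ltW yx] := leP x y; first exact: h.
  by rewrite distrC [X in _ * X]distrC; exact: h.
have sub : {subset `[x, y] <= `[A, B]}.
  move=> z; move: xAB yAB; rewrite !in_itv/=.
  move=> /andP[? ?] /andP[? ?] /andP[? ?]; apply/andP; split; lra.
have FdG z : z \in `]x, y[ -> is_derive z 1 F (G z).
  move=> zxy; apply: (@is_deriv_on_interior _ A B).
    move: xAB yAB zxy; rewrite !in_itv/= => /andP[? ?] /andP[? ?] /andP[? ?].
    by apply/andP; split; lra.
  by apply: FG; apply: sub; exact: subset_itv_oo_cc.
have cF : {within `[x, y], continuous F}.
  apply: (@continuous_subspaceW _ _ _ `[A, B]); first exact: sub.
  by apply: is_deriv_on_continuous => u uAB; exists (G u); exact: FG.
have [c cxy FE] := MVT_segment xy FdG cF.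
rewrite distrC FE normrM [X in _ * X <= _]distrC ler_wpM2r//.
by apply: GM; exact: sub.
Qed.

Definition clamp A B u := Num.max A (Num.min B u).

Lemma clamp_itv A B u : A <= B -> clamp A B u \in `[A, B].
Proof.
by move=> AB; rewrite in_itv/= /clamp le_max lexx ge_max ge_min lexx AB.
Qed.

Lemma clamp_id A B u : u \in `[A, B] -> clamp A B u = u.
Proof. by rewrite in_itv/= /clamp => /andP[Au uB]; rewrite min_r// max_r. Qed.

Lemma clamp_le A B u : A <= B -> u <= A -> clamp A B u = A.
Proof. by move=> AB uA; rewrite /clamp min_r ?max_l//; exact: le_trans AB. Qed.

Lemma clamp_ge A B u : A <= B -> B <= u -> clamp A B u = B.
Proof. by move=> AB Bu; rewrite /clamp min_l ?max_r. Qed.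

Lemma clamp_lipschitz A B x y : A <= B ->
  `|clamp A B x - clamp A B y| <= `|x - y|.
Proof.
move=> AB; wlog xy : x y / x <= y.
  move=> h; have [|/ltW yx] := leP x y; first exact: h.
  by rewrite distrC [leRHS]distrC; exact: h.
rewrite [leRHS]distrC [leRHS]ger0_norm ?subr_ge0// /clamp.
case: (leP B x) => Bx; case: (leP B y) => By; rewrite ?(max_r AB).
- by rewrite subrr normr0 subr_ge0.
- lra.
- by case: (leP A x) => Ax; rewrite ler_norml; apply/andP; split; lra.
- by case: (leP A x) => Ax; case: (leP A y) => Ay; rewrite ler_norml;
    apply/andP; split; lra.
Qed.

(** Composing with the clamp extends [F] by constants, which gives a two-sided
derivative everywhere but at the two corners. *)
Lemma clamp_derivative A B F G : A < B ->
  (forall u, u \in `[A, B] -> is_deriv_on A B F u (G u)) ->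
  forall u, u != A -> u != B ->
    (F (clamp A B y) - F (clamp A B u)) / (y - u) @[y --> u^'] -->
    (G \_ `[A, B]) u.
Proof.
move=> AB FG u uA uB; apply: (@is_deriveP _ (F \o clamp A B)).
have [uAB|uAB] := boolP (u \in `[A, B]).
  have uAB' : u \in `]A, B[.
    move: uAB; rewrite !in_itv/= => /andP[Au ub].
    by rewrite !lt_neqAle Au ub uB eq_sym uA.
  rewrite patchE mem_set//.
  apply: (@near_eq_is_derive _ _ _ F); rewrite ?oner_eq0//.
    near=> y; rewrite /= clamp_id//; apply: subset_itv_oo_cc.
    by near: y; exact: near_in_itvoo.
  by apply: is_deriv_on_interior (FG _ uAB).
rewrite patchE ifF; last by apply/negP => /set_mem /=; rewrite (negbTE uAB).
move: uAB; rewrite in_itv/= negb_and -!ltNge => /orP[uA'|Bu].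
  apply: (@near_eq_is_derive _ _ _ (cst (F A))); rewrite ?oner_eq0//.
  near=> y; rewrite /= clamp_le//; first exact: ltW.
  by apply: ltW; near: y; exact: lt_nbhsl.
apply: (@near_eq_is_derive _ _ _ (cst (F B))); rewrite ?oner_eq0//.
near=> y; rewrite /= clamp_ge//; first exact: ltW.
by apply: ltW; near: y; exact: lt_nbhsr.
Unshelve. all: end_near. Qed.

(** Replaces the [s]-dependent domain of integration by a fixed one: for
[v > s - A] the argument [s - v] falls below [A], where [H] vanishes. *)
Lemma riemann_liouville_extend A B e F H s : s \in `[A, B] ->
  {in `[A, B], F =1 H} -> (forall u, u < A -> H u = 0) ->
  riemann_liouville A e F s =
  \int[mu]_(v in `[0, B - A]) (v `^ e * H (s - v)).
Proof.
move=> /itvP sAB FH H0; rewrite /riemann_liouville Rintegral_mkcond.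
rewrite [RHS]Rintegral_mkcond; congr Rintegral; apply/funext => v.
rewrite !patchE !mem_setE !in_itv/=.
have [v0/=|//] := leP 0 v.
have [vs|vs] := leP v (s - A).
  rewrite ifT ?FH// ?(le_trans vs)// ?lerD2r ?sAB//.
  by rewrite in_itv/= lerBrDl addrC -lerBrDl vs lerBlDr ler_wpDr// sAB.
by rewrite H0 ?mulr0 ?if_same// ltrBlDl addrC -ltrBlDl.
Qed.

(** [F A = 0] is what lets the constant extension of [F] below [A] be the
extension by zero; otherwise a boundary term (s - A)^e F(A) would appear. *)
Lemma riemann_liouville_deriv A B e F G s : A < B -> 0 < e + 1 ->
  (forall u, u \in `[A, B] -> is_deriv_on A B F u (G u)) ->
  {within `[A, B], continuous G} -> F A = 0 -> s \in `[A, B] ->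
  is_deriv_on A B (riemann_liouville A e F) s (riemann_liouville A e G s).
Proof.
move=> AB e1 FG cG FA sAB.
have [M M0 GM] := within_continuous_bounded cG.
rewrite (@riemann_liouville_extend _ B _ G (G \_ `[A, B]))//; last 2 first.
- by move=> u uAB; rewrite patchE mem_set.
- by move=> u uA; rewrite patchE mem_setE in_itv/= leNgt uA.
pose H u := F (clamp A B u).
apply: (@eq_is_deriv_on _ _ _
    (fun y => \int[mu]_(v in `[0, B - A]) (v `^ e * H (y - v)))) => //.
  move=> y yAB; rewrite (@riemann_liouville_extend _ B _ F H)//.
  - by move=> u uAB; rewrite /H clamp_id.
  - by move=> u uA; rewrite /H clamp_le// ltW.
apply: cvg_within_filter.
apply: (@convolution_derivative _ (fun v => v `^ e) H (G \_ `[A, B]) M _ A B).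
- exact: powR_integrable.
- move=> x y; have := deriv_on_lipschitz AB FG GM
    (clamp_itv x (ltW AB)) (clamp_itv y (ltW AB)).
  by move=> /le_trans; apply; rewrite ler_wpM2l// clamp_lipschitz// ltW.
- exact: clamp_derivative.
- apply/(measurable_restrictT _ _).1 => //.
  exact: subspace_continuous_measurable_fun.
Qed.

End RiemannLiouville.

(** * Taylor remainders *)

Section Taylor.
Context {R : realType}.
Implicit Types (A B e s u : R) (X : nat -> R -> R).

(** With [X k] the k-th derivative of [X 0], this is the Taylor remainder of
order [n - k] of [X k] at [A], which is also the k-th derivative of the
remainder of order [n] of [X 0]. *)
Definition taylor_rem A n X k u : R :=
  X k u - \sum_(j < n - k) (u - A) ^+ j / j`!%:R * X (k + j)%N A.

Lemma is_deriv_on_exprn a b A n t :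
  is_deriv_on a b (fun u => (u - A) ^+ n.+1) t (n.+1%:R * (t - A) ^+ n).
Proof.
have d : is_deriv_on a b (fun u => u - A) t 1.
  rewrite -[1]subr0; apply: is_deriv_onB; last exact: is_deriv_on_cst.
  by apply: is_derive_on; exact: is_derive_id.
elim: n => [|n IHn].
  by rewrite expr0 mulr1; under eq_fun do rewrite expr1.
under eq_fun do rewrite exprS.
have -> : n.+2%:R * (t - A) ^+ n.+1 =
    1 * (t - A) ^+ n.+1 + (t - A) * (n.+1%:R * (t - A) ^+ n).
  by rewrite -[n.+2%:R]natr1 exprS; ring.
exact: (is_deriv_onM d IHn).
Qed.

Lemma taylor_rem_deriv a b A n X k t : (k < n)%N ->
  is_deriv_on a b (X k) t (X k.+1 t) ->
  is_deriv_on a b (taylor_rem A n X k) t (taylor_rem A n X k.+1 t).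
Proof.
move=> kn Xk.
pose d j := if j is i.+1 then (t - A) ^+ i / i`!%:R * X (k.+1 + i)%N A else 0.
have -> : taylor_rem A n X k.+1 t = X k.+1 t - \sum_(j < n - k) d j.
  by rewrite -(subnSK kn) big_ord_recl add0r.
apply: is_deriv_onB => //; apply: (@is_deriv_on_sum _ a b _
  (fun j u => (u - A) ^+ j / j`!%:R * X (k + j)%N A)) => -[|j] jn /=.
  under eq_fun do rewrite expr0.
  exact: is_deriv_on_cst.
under eq_fun do rewrite -mulrA mulrC.
have -> : (t - A) ^+ j / j`!%:R * X (k.+1 + j)%N A =
    (j.+1`!%:R^-1 * X (k + j.+1)%N A) * (j.+1%:R * (t - A) ^+ j).
  have j0 : (j`!)%:R != 0 :> R by rewrite pnatr_eq0 -lt0n fact_gt0.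
  rewrite factS natrM addSnnS; field.
  by rewrite j0 nat1r pnatr_eq0.
by apply: is_deriv_onZ; exact: is_deriv_on_exprn.
Qed.

Lemma taylor_rem_base A n X k : (k < n)%N -> taylor_rem A n X k A = 0.
Proof.
move=> kn; rewrite /taylor_rem -(subnSK kn) big_ord_recl/= addn0.
rewrite expr0 fact0 divr1 mul1r big1 ?addr0 ?subrr// => i _.
by rewrite expr0n/= !mul0r.
Qed.

Lemma taylor_rem_top A n X u : taylor_rem A n X n u = X n u.
Proof. by rewrite /taylor_rem subnn big_ord0 subr0. Qed.

Lemma taylor_rem_chain A B n X : op_chain A B (fun=> 1) n X ->
  forall k u, (k < n)%N -> u \in `[A, B] ->
    is_deriv_on A B (taylor_rem A n X k) u (taylor_rem A n X k.+1 u).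
Proof.
move=> Xch k u kn uAB; apply: taylor_rem_deriv => //.
by have [l Xl ->] := Xch k u kn uAB; rewrite mul1r.
Qed.

Lemma taylor_rem_continuous A B n X k : op_chain A B (fun=> 1) n X ->
  {within `[A, B], continuous (X n)} -> (k <= n)%N ->
  {within `[A, B], continuous (taylor_rem A n X k)}.
Proof.
move=> Xch cXn; rewrite leq_eqVlt => /predU1P[->|kn].
  rewrite (_ : taylor_rem A n X n = X n)//; apply/funext => u.
  exact: taylor_rem_top.
apply: is_deriv_on_continuous => u uAB.
by exists (taylor_rem A n X k.+1 u); exact: taylor_rem_chain.
Qed.

Lemma riemann_liouville_taylor_rem A B e n X : A < B -> 0 < e + 1 ->
  op_chain A B (fun=> 1) n X -> {within `[A, B], continuous (X n)} ->
  op_chain A B (fun=> 1) n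
    (fun k => riemann_liouville A e (taylor_rem A n X k)).
Proof.
move=> AB e1 Xch cXn k t kn tAB.
exists (riemann_liouville A e (taylor_rem A n X k.+1) t); last by rewrite mul1r.
apply: riemann_liouville_deriv => //.
- by move=> u uAB; exact: taylor_rem_chain.
- exact: taylor_rem_continuous.
- exact: taylor_rem_base.
Qed.

End Taylor.

(** * Monotone substitution with a singular end point *)

Section SingularSubstitution.
Context {R : realType}.
Implicit Types (a b : R) (phi G : R -> R).
Notation mu := (@lebesgue_measure R).

Lemma derive1_cvg_right phi a : {for a, continuous phi^`()%classic} ->
  cvg (phi^`()%classic x @[x --> a^'+]).
Proof.
by move=> c; apply/cvg_ex; exists (phi^`()%classic a);
  exact: cvg_at_right_filter.
Qed.

Lemma derive1_cvg_left phi a : {for a, continuous phi^`()%classic} ->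
  cvg (phi^`()%classic x @[x --> a^'-]).
Proof.
by move=> c; apply/cvg_ex; exists (phi^`()%classic a);
  exact: cvg_at_left_filter.
Qed.

Lemma cvg_shrink a b : a + (b - a) / n.+2%:R @[n --> \oo] --> a.
Proof.
rewrite -[X in _ --> X]addr0; apply: cvgD; first exact: cvg_cst.
rewrite -(mulr0 (b - a)); apply: cvgM; first exact: cvg_cst.
by have := @cvg_harmonic R; rewrite -cvg_shiftS; exact.
Qed.

Lemma shrink_gt a b n : a < b -> a < a + (b - a) / n.+2%:R < b.
Proof.
move=> ab; rewrite ltrDl divr_gt0 ?subr_gt0//= -ltrBrDl.
by rewrite gtr_pMr ?subr_gt0// invf_lt1// ltr1n.
Qed.

(** Substitution with [G] possibly discontinuous at [phi b]: the two sides over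
[a, u n], with [u n] increasing to [b], agree because [G] is continuous on
[phi (u n), phi a], and both converge since the integrands are nonnegative. *)
Lemma ge0_substitution_decreasing phi G a b : a < b ->
  {in `[a, b] &, {homo phi : x y /~ x < y}} ->
  {in `[a, b], forall x, derivable phi x 1} ->
  {in `[a, b], forall x, {for x, continuous phi^`()%classic}} ->
  {in `[a, b], forall x, phi^`()%classic x <= 0} ->
  (forall c, phi b < c -> {within `[c, phi a], continuous G}) ->
  {in `[phi b, phi a], forall v, 0 <= G v} ->
  measurable_fun `[phi b, phi a] G ->
  measurable_fun `[a, b] ((G \o phi) * - phi^`()%classic) ->
  (\int[mu]_(v in `[phi b, phi a]) (G v)%:E =
   \int[mu]_(x in `[a, b]) (((G \o phi) * - phi^`()%classic) x)%:E)%E.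
Proof.
move=> ab dec dphi cphi phi0 cG G0 mG mGphi.
pose u n := b + (a - b) / n.+2%:R.
have ucvg : u n @[n --> \oo] --> b by exact: cvg_shrink.
have uab n : a < u n < b.
  have := @shrink_gt (- b) (- a) n; rewrite ltrN2 => /(_ ab).
  rewrite -opprD mulNr /u; set q := (a - b) / _.
  by move=> /andP[? ?]; apply/andP; split; lra.
have uin n : u n \in `[a, b] by rewrite in_itv/= !ltW//; case/andP: (uab n).
have ain : a \in `[a, b] by rewrite in_itv/= lexx ltW.
have bin : b \in `[a, b] by rewrite in_itv/= lexx ltW.
have und : nondecreasing_seq u.
  move=> m n mn; rewrite /u lerD2l ler_wnM2l//; first by rewrite subr_le0 ltW.
  by rewrite lef_pV2 ?posrE// ler_nat.
have H1 := ge0_integral_exhaust_right (f := (G \o phi) * - phi^`()%classic)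
  mGphi _ und (fun n => proj2 (andP (uab n))) ucvg.
have H2 : (\int[mu]_(v in `[phi (u n), phi a]) (G v)%:E @[n --> \oo] -->
   \int[mu]_(v in `[phi b, phi a]) (G v)%:E)%E.
  apply: ge0_integral_exhaust_left => //.
  - move=> m n mn; have := und _ _ mn; rewrite le_eqVlt => /predU1P[->//|h].
    by rewrite ltW// dec.
  - by move=> n; rewrite dec//; case/andP: (uab n).
  - apply: continuous_cvg => //.
    by apply: differentiable_continuous; apply/derivable1_diffP; exact: dphi.
have E n : (\int[mu]_(v in `[phi (u n), phi a]) (G v)%:E =
    \int[mu]_(x in `[a, u n]) (((G \o phi) * - phi^`()%classic) x)%:E)%E.
  have /andP[aun unb] := uab n.
  have sub : {subset `[a, u n] <= `[a, b]}.
    by apply: subset_itvl; rewrite bnd_simp ltW.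
  apply: integration_by_substitution_decreasing.
  - exact: ltW.
  - by move=> x y /sub xab /sub yab; exact: dec.
  - by move=> x /subset_itv_oo_cc/sub; exact: cphi.
  - by apply: derive1_cvg_right; exact: cphi.
  - by apply: derive1_cvg_left; exact: cphi.
  - by apply: derivable_cc_LRcontinuous => // x /sub; exact: dphi.
  - by apply: cG; exact: dec.
move: H2; under eq_fun do rewrite E.
move=> H2; apply: (cvg_unique _ H2) => //.
apply: H1 => x xab; rewrite fctE /= mulr_ge0//.
  apply: G0; rewrite in_itv/=; move: (xab); rewrite in_itv/= => /andP[ax xb].
  have ndec : {in `[a, b] &, {homo phi : x y /~ x <= y}}.
    move=> y z yab zab; rewrite le_eqVlt => /predU1P[->//|yz].
    by rewrite ltW// dec.
  by rewrite !ndec.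
by rewrite oppr_ge0 phi0.
Qed.

(** Mirror image of the previous lemma: the singularity of [G] sits at [phi a],
the image of the left end point. *)
Lemma ge0_substitution_increasing phi G a b : a < b ->
  {in `[a, b] &, {homo phi : x y / x < y}} ->
  {in `[a, b], forall x, derivable phi x 1} ->
  {in `[a, b], forall x, {for x, continuous phi^`()%classic}} ->
  {in `[a, b], forall x, 0 <= phi^`()%classic x} ->
  (forall c, phi a < c -> {within `[c, phi b], continuous G}) ->
  {in `[phi a, phi b], forall v, 0 <= G v} ->
  measurable_fun `[phi a, phi b] G ->
  measurable_fun `[a, b] ((G \o phi) * phi^`()%classic) ->
  (\int[mu]_(v in `[phi a, phi b]) (G v)%:E =
   \int[mu]_(x in `[a, b]) (((G \o phi) * phi^`()%classic) x)%:E)%E.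
Proof.
move=> ab inc dphi cphi phi0 cG G0 mG mGphi.
pose u n := a + (b - a) / n.+2%:R.
have ucvg : u n @[n --> \oo] --> a by exact: cvg_shrink.
have uab n : a < u n < b by exact: shrink_gt.
have uin n : u n \in `[a, b] by rewrite in_itv/= !ltW//; case/andP: (uab n).
have ain : a \in `[a, b] by rewrite in_itv/= lexx ltW.
have bin : b \in `[a, b] by rewrite in_itv/= lexx ltW.
have uni : nonincreasing_seq u.
  move=> m n mn; rewrite /u lerD2l ler_wpM2l//; first by rewrite subr_ge0 ltW.
  by rewrite lef_pV2 ?posrE// ler_nat.
have H1 := ge0_integral_exhaust_left (f := (G \o phi) * phi^`()%classic) mGphi _
  uni (fun n => proj1 (andP (uab n))) ucvg.
have H2 : (\int[mu]_(v in `[phi (u n), phi b]) (G v)%:E @[n --> \oo] -->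
   \int[mu]_(v in `[phi a, phi b]) (G v)%:E)%E.
  apply: ge0_integral_exhaust_left => //.
  - move=> m n mn; have := uni _ _ mn; rewrite le_eqVlt => /predU1P[->//|h].
    by rewrite ltW// inc.
  - by move=> n; rewrite inc//; case/andP: (uab n).
  - apply: continuous_cvg => //.
    by apply: differentiable_continuous; apply/derivable1_diffP; exact: dphi.
have E n : (\int[mu]_(v in `[phi (u n), phi b]) (G v)%:E =
    \int[mu]_(x in `[u n, b]) (((G \o phi) * phi^`()%classic) x)%:E)%E.
  have /andP[aun unb] := uab n.
  have sub : {subset `[u n, b] <= `[a, b]}.
    by apply: subset_itvr; rewrite bnd_simp ltW.
  apply: integration_by_substitution_increasing.
  - exact: ltW.
  - by move=> x y /sub xab /sub yab; exact: inc.
  - by move=> x /subset_itv_oo_cc/sub; exact: cphi.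
  - by apply: derive1_cvg_right; exact: cphi.
  - by apply: derive1_cvg_left; exact: cphi.
  - by apply: derivable_cc_LRcontinuous => // x /sub; exact: dphi.
  - by apply: cG; exact: inc.
move: H2; under eq_fun do rewrite E.
move=> H2; apply: (cvg_unique _ H2) => //.
apply: H1 => x xab; rewrite fctE /= mulr_ge0//; last exact: phi0.
apply: G0; rewrite in_itv/=; move: (xab); rewrite in_itv/= => /andP[ax xb].
have ndec : {in `[a, b] &, {homo phi : x y / x <= y}}.
  move=> y z yab zab; rewrite le_eqVlt => /predU1P[->//|yz].
  by rewrite ltW// inc.
by rewrite !ndec.
Qed.

End SingularSubstitution.

(** * From nonnegative to signed integrands *)

Section PowerSubstitution.
Context {R : realType}.
Implicit Types (a b e c rho t S : R) (h phi k : R -> R).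
Notation mu := (@lebesgue_measure R).

(** The identity for [h = 1] makes [k] integrable.  A continuous [h] is bounded
by some [M], so both [h + M] and [M] are covered by the nonnegative case, and
subtracting gives the identity for [h]. *)
Lemma signed_substitution (D : set R) k phi rho e S :
  measurable D -> 0 < rho -> 0 < e + 1 ->
  measurable_fun D k -> (forall x, D x -> 0 <= k x) ->
  measurable_fun D phi -> (forall x, D x -> phi x \in `[0, S]) ->
  (forall h, {within `[0, S], continuous h} ->
    {in `[0, S], forall v, 0 <= h v} ->
    (\int[mu]_(v in `[0%R, S]%classic) (v `^ e * h v)%:E =
     \int[mu]_(x in D) (rho * (k x * h (phi x)))%:E)%E) ->
  forall h, {within `[0, S], continuous h} ->
    mu.-integrable D (fun x => (k x * h (phi x))%:E) /\
    \int[mu]_(x in D) (k x * h (phi x)) =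
      rho^-1 * \int[mu]_(v in `[0, S]) (v `^ e * h v).
Proof.
move=> mD rho0 e1 mk k0 mphi phiS hyp h ch.
have ipow := @powR_integrable R S e e1.
have rho_neq0 : rho != 0 by rewrite gt_eqF.
have irk : mu.-integrable D (fun x => (rho * k x)%:E).
  apply/integrableP; split.
    by apply/measurable_EFinP; apply: measurable_funM.
  have -> : (\int[mu]_(x in D) `|(rho * k x)%:E| =
      \int[mu]_(v in `[0%R, S]%classic) (v `^ e)%:E)%E.
    under [RHS]eq_integral do rewrite -[_ `^ _]mulr1.
    rewrite (hyp (cst 1))//; last by move=> x; exact: cst_continuous.
    apply: eq_integral => x /set_mem xD.
    by rewrite /= mulr1 ger0_norm// mulr_ge0 ?k0// ltW.
  rewrite -ge0_fin_numE; last first.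
    by apply: integral_ge0 => v _; rewrite lee_fin powR_ge0.
  exact: integrable_fin_num.
have ik : mu.-integrable D (EFin \o k).
  have := @integrableZl _ _ _ mu D mD rho^-1 _ irk.
  apply: eq_integrable => // x _ /=.
  by rewrite -EFinM mulKf.
have [M M0 hM] := within_continuous_bounded ch.
have mh : measurable_fun `[0, S] h by exact: subspace_continuous_measurable_fun.
have mhphi : measurable_fun D (h \o phi).
  apply: (measurable_comp _ _ mh mphi) => //.
  by move=> _ [x /phiS xS <-].
have ikh : mu.-integrable D (EFin \o (fun x => k x * h (phi x))).
  by apply: (@integrable_kernelM _ _ _ (h \o phi) M) => // x /phiS /hM.
split => //.
have iph : mu.-integrable `[0, S] (EFin \o (fun v : R => v `^ e * h v)).
  by apply: (@integrable_kernelM _ _ (fun v : R => v `^ e) h M).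
have ikM : mu.-integrable D (EFin \o (fun x => k x * M)).
  by apply: (@integrable_kernelM _ _ _ (cst M) M) => // x _; rewrite ger0_norm.
have ipM : mu.-integrable `[0, S] (EFin \o (fun v : R => v `^ e * M)).
  apply: (@integrable_kernelM _ _ (fun v : R => v `^ e) (cst M) M) => // x _.
  by rewrite ger0_norm.
have tr (g : R -> R) : {within `[0, S], continuous g} ->
    {in `[0, S], forall v, 0 <= g v} ->
    mu.-integrable D (EFin \o (fun x => k x * g (phi x))) ->
    \int[mu]_(v in `[0, S]) (v `^ e * g v) =
    rho * \int[mu]_(x in D) (k x * g (phi x)).
  by move=> cg g0 ig; rewrite -RintegralZl// /Rintegral hyp.
have sumS : \int[mu]_(v in `[0, S]) (v `^ e * (h v + M)) =
    \int[mu]_(v in `[0, S]) (v `^ e * h v) +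
    \int[mu]_(v in `[0, S]) (v `^ e * M).
  by rewrite -RintegralD//; apply: eq_Rintegral => v _; rewrite mulrDr.
have sumD : \int[mu]_(x in D) (k x * (h (phi x) + M)) =
    \int[mu]_(x in D) (k x * h (phi x)) + \int[mu]_(x in D) (k x * M).
  by rewrite -RintegralD//; apply: eq_Rintegral => v _; rewrite mulrDr.
have trM : \int[mu]_(v in `[0, S]) (v `^ e * M) =
    rho * \int[mu]_(x in D) (k x * M).
  by apply: (tr (cst M)) => // x; exact: cst_continuous.
have trhM : \int[mu]_(v in `[0, S]) (v `^ e * (h v + M)) =
    rho * \int[mu]_(x in D) (k x * (h (phi x) + M)).
  apply: (tr (fun v => h v + M)).
  - by move=> x; apply: cvgD; [exact: ch|exact: cvg_cst].
  - move=> v vS; have := hM v vS; rewrite ler_norml => /andP[? _].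
    by rewrite -lerBlDr sub0r.
  - have ihM := integrableD _ ikh ikM.
    apply: eq_integrable (ihM mD) => // x _ /=.
    by rewrite mulrDr.
rewrite (_ : \int[mu]_(v in `[0, S]) (v `^ e * h v) =
  rho * \int[mu]_(x in D) (k x * h (phi x))); first by rewrite mulKf.
move: trhM; rewrite sumS sumD trM mulrDr; exact: addIr.
Qed.

End PowerSubstitution.

(** * The two Katugampola kernels *)

Section KatugampolaKernels.
Context {R : realType}.
Implicit Types (a b e c rho t S : R) (h phi k : R -> R).
Notation mu := (@lebesgue_measure R).

Lemma is_derive_powR_affine sg rho c t : 0 < t ->
  is_derive t 1 (fun y => sg * y `^ rho + c) (sg * (rho * t `^ (rho - 1))).
Proof.
move=> t0; have d := is_derive1_powR rho t0.
rewrite (_ : (fun _ => _) = sg \*: (fun y : R => y `^ rho) + cst c)//.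
by apply: is_derive_eq; rewrite addr0.
Qed.

Lemma derive1_powR_affine sg rho c t : 0 < t ->
  ((fun y : R => sg * y `^ rho + c)^`())%classic t =
  sg * (rho * t `^ (rho - 1)).
Proof.
move=> t0; rewrite derive1E.
by have [_ ->] := is_derive_powR_affine sg rho c t0.
Qed.

Lemma continuous_derive1_powR_affine sg rho c t : 0 < t ->
  {for t, continuous ((fun y : R => sg * y `^ rho + c)^`())%classic}.
Proof.
move=> t0; rewrite /prop_for /continuous_at derive1_powR_affine//.
have c1 : (sg * (rho * y `^ (rho - 1))) @[y --> t] -->
    sg * (rho * t `^ (rho - 1)).
  apply: cvgM; first exact: cvg_cst.
  apply: cvgM; first exact: cvg_cst.
  have : {for t, continuous (fun y : R => y `^ (rho - 1))}.
    apply: differentiable_continuous; apply/derivable1_diffP.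
    by apply: derivable_powR; rewrite in_itv/= andbT.
  exact.
apply: cvg_trans c1; apply: near_eq_cvg.
near=> y; rewrite derive1_powR_affine//.
by near: y; exact: lt_nbhsr.
Unshelve. all: end_near. Qed.

Lemma measurable_kernel (D : set R) sg rho c e : measurable D ->
  measurable_fun D (fun x => x `^ (rho - 1) * (sg * x `^ rho + c) `^ e).
Proof.
move=> mD; apply: measurable_funM.
  by apply: measurable_funTS; exact: measurable_powR.
apply: measurable_funTS.
apply: (@measurableT_comp _ _ _ _ _ _ (@powR R ^~ e)).
  exact: measurable_powR.
apply: measurable_funD => //; apply: measurable_funM => //.
Qed.

Lemma continuous_powRM e h S c : 0 < c -> {within `[0, S], continuous h} ->
  {within `[c, S], continuous (fun v => v `^ e * h v)}.
Proof.
move=> c0 ch.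
have cp : {within `[c, S], continuous (fun v : R => v `^ e)}.
  apply: derivable_within_continuous => x; rewrite in_itv/= => /andP[cx _].
  by apply: derivable_powR; rewrite in_itv/= andbT (lt_le_trans c0).
have ch' : {within `[c, S], continuous h}.
  apply: continuous_subspaceW ch.
  by apply: subset_itvr; rewrite bnd_simp ltW.
by move=> x; apply: cvgM; [exact: cp|exact: ch'].
Qed.

(** Substitution [v = t^rho - x^rho], which decreases from [t^rho - a^rho] to
the singular value [0] as [x] runs from [a] to [t]. *)
Lemma left_substitution a rho e t h : 0 < a -> a <= t -> 0 < rho ->
  0 < e + 1 -> {within `[0, t `^ rho - a `^ rho], continuous h} ->
  mu.-integrable `[a, t] (fun x =>
    (x `^ (rho - 1) * (t `^ rho - x `^ rho) `^ e *
     h (t `^ rho - x `^ rho))%:E) /\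
  \int[mu]_(x in `[a, t]) (x `^ (rho - 1) * (t `^ rho - x `^ rho) `^ e *
     h (t `^ rho - x `^ rho)) =
  rho^-1 * \int[mu]_(v in `[0, t `^ rho - a `^ rho]) (v `^ e * h v).
Proof.
move=> a0 at_ rho0 e1.
pose phi (x : R) := -1 * x `^ rho + t `^ rho.
have phiE x : phi x = t `^ rho - x `^ rho by rewrite /phi mulN1r addrC.
have phit : phi t = 0 by rewrite phiE subrr.
have x0 x : x \in `[a, t] -> 0 < x.
  by rewrite in_itv/= => /andP[ax _]; exact: lt_le_trans ax.
have dec : {in `[a, t] &, {homo phi : x y /~ x < y}}.
  move=> x y /x0 xp /x0 yp xy; rewrite !phiE ltrD2l ltrN2.
  by apply: gt0_ltr_powR; rewrite // nnegrE ltW.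
have ndec : {in `[a, t] &, {homo phi : x y /~ x <= y}}.
  move=> y z yab zab; rewrite le_eqVlt => /predU1P[->//|yz].
  by rewrite ltW// dec.
have ain : a \in `[a, t] by rewrite in_itv/= lexx.
have tin : t \in `[a, t] by rewrite in_itv/= lexx andbT.
have phiS x : x \in `[a, t] -> phi x \in `[0, phi a].
  move=> xat; rewrite in_itv/= -[X in X <= _]phit.
  by move: (xat); rewrite in_itv/= => /andP[ax xt]; rewrite !ndec.
pose k (x : R) := x `^ (rho - 1) * (t `^ rho - x `^ rho) `^ e.
have mk : measurable_fun `[a, t] k.
  apply: eq_measurable_fun
    (@measurable_kernel `[a, t] (-1) rho (t `^ rho) e _) => //.
  by move=> x _; rewrite /k -phiE.
have mphi : measurable_fun `[a, t] (fun x => t `^ rho - x `^ rho).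
  apply: measurable_funB => //; apply: measurable_funTS.
  exact: measurable_powR.
move: h; apply: (@signed_substitution _ `[a, t]%classic k
  (fun x => t `^ rho - x `^ rho)) => //.
- by move=> x _; rewrite mulr_ge0 ?powR_ge0.
- by move=> x /= xat; rewrite -!phiE phiS.
move=> h ch h0.
have [->|ant] := eqVneq a t; first by rewrite subrr !set_itv1 !integral_set1.
have altt : a < t by rewrite lt_neqAle ant.
have E : {in `[a, t], forall x, rho * (k x * h (t `^ rho - x `^ rho)) =
    (((fun v => v `^ e * h v) \o phi) * - phi^`()%classic) x}.
  move=> x /x0 xp; rewrite !fctE /= derive1_powR_affine// phiE.
  by rewrite mulN1r opprK /k; ring.
have mh : measurable_fun `[0, phi a] h.
  by apply: subspace_continuous_measurable_fun => //; rewrite phiE.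
rewrite -(phiE a) -[in LHS]phit.
rewrite (@ge0_substitution_decreasing _ phi (fun v => v `^ e * h v))//.
- by apply: eq_integral => x /set_mem/E ->.
- by move=> x /x0 xp; have [] := is_derive_powR_affine (-1) rho (t `^ rho) xp.
- by move=> x /x0 xp; exact: continuous_derive1_powR_affine.
- move=> x /x0 xp; rewrite derive1_powR_affine// mulN1r oppr_le0.
  by rewrite mulr_ge0 ?powR_ge0// ltW.
- move=> c; rewrite phit => c0; apply: continuous_powRM => //.
  by rewrite phiE.
- by move=> v; rewrite phit phiE => /h0 hv; rewrite mulr_ge0 ?powR_ge0.
- rewrite phit; apply: measurable_funM => //.
  by apply: measurable_funTS; exact: measurable_powR.
- apply: (eq_measurable_fun (fun x => rho * (k x * h (t `^ rho - x `^ rho)))).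
    by move=> x /set_mem/E.
  apply: measurable_funM => //; apply: measurable_funM => //.
  apply: (measurable_comp _ _ mh mphi) => //.
  by move=> _ [x /= xat <-]; rewrite -phiE phiS.
Qed.

(** Substitution [v = x^rho - t^rho], which increases from the singular value
[0] as [x] runs from [t] to [b]. *)
Lemma right_substitution b rho e t h : 0 < t -> t <= b -> 0 < rho ->
  0 < e + 1 -> {within `[0, b `^ rho - t `^ rho], continuous h} ->
  mu.-integrable `[t, b] (fun x =>
    (x `^ (rho - 1) * (x `^ rho - t `^ rho) `^ e *
     h (x `^ rho - t `^ rho))%:E) /\
  \int[mu]_(x in `[t, b]) (x `^ (rho - 1) * (x `^ rho - t `^ rho) `^ e *
     h (x `^ rho - t `^ rho)) =
  rho^-1 * \int[mu]_(v in `[0, b `^ rho - t `^ rho]) (v `^ e * h v).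
Proof.
move=> t0 tb rho0 e1.
pose phi (x : R) := 1 * x `^ rho + - t `^ rho.
have phiE x : phi x = x `^ rho - t `^ rho by rewrite /phi mul1r.
have phit : phi t = 0 by rewrite phiE subrr.
have x0 x : x \in `[t, b] -> 0 < x.
  by rewrite in_itv/= => /andP[tx _]; exact: lt_le_trans tx.
have inc : {in `[t, b] &, {homo phi : x y / x < y}}.
  move=> x y /x0 xp /x0 yp xy; rewrite !phiE ltrD2r.
  by apply: gt0_ltr_powR; rewrite // nnegrE ltW.
have ninc : {in `[t, b] &, {homo phi : x y / x <= y}}.
  move=> y z yab zab; rewrite le_eqVlt => /predU1P[->//|yz].
  by rewrite ltW// inc.
have bin : b \in `[t, b] by rewrite in_itv/= lexx andbT.
have tin : t \in `[t, b] by rewrite in_itv/= lexx.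
have phiS x : x \in `[t, b] -> phi x \in `[0, phi b].
  move=> xat; rewrite in_itv/= -[X in X <= _]phit.
  by move: (xat); rewrite in_itv/= => /andP[tx xb]; rewrite !ninc.
pose k (x : R) := x `^ (rho - 1) * (x `^ rho - t `^ rho) `^ e.
have mk : measurable_fun `[t, b] k.
  apply: eq_measurable_fun
    (@measurable_kernel `[t, b] 1 rho (- t `^ rho) e _) => //.
  by move=> x _; rewrite /k -phiE.
have mphi : measurable_fun `[t, b] (fun x => x `^ rho - t `^ rho).
  apply: measurable_funB => //; apply: measurable_funTS.
  exact: measurable_powR.
move: h; apply: (@signed_substitution _ `[t, b]%classic k
  (fun x => x `^ rho - t `^ rho)) => //.
- by move=> x _; rewrite mulr_ge0 ?powR_ge0.
- by move=> x /= xat; rewrite -!phiE phiS.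
move=> h ch h0.
have [->|tnb] := eqVneq t b; first by rewrite subrr !set_itv1 !integral_set1.
have tltb : t < b by rewrite lt_neqAle tnb.
have E : {in `[t, b], forall x, rho * (k x * h (x `^ rho - t `^ rho)) =
    (((fun v => v `^ e * h v) \o phi) * phi^`()%classic) x}.
  move=> x /x0 xp; rewrite !fctE /= derive1_powR_affine// phiE.
  by rewrite mul1r /k; ring.
have mh : measurable_fun `[0, phi b] h.
  by apply: subspace_continuous_measurable_fun => //; rewrite phiE.
rewrite -(phiE b) -[in LHS]phit.
rewrite (@ge0_substitution_increasing _ phi (fun v => v `^ e * h v))//.
- by apply: eq_integral => x /set_mem/E ->.
- by move=> x /x0 xp; have [] := is_derive_powR_affine 1 rho (- t `^ rho) xp.
- by move=> x /x0 xp; exact: continuous_derive1_powR_affine.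
- move=> x /x0 xp; rewrite derive1_powR_affine// mul1r.
  by rewrite mulr_ge0 ?powR_ge0// ltW.
- move=> c; rewrite phit => c0; apply: continuous_powRM => //.
  by rewrite phiE.
- by move=> v; rewrite phit phiE => /h0 hv; rewrite mulr_ge0 ?powR_ge0.
- rewrite phit; apply: measurable_funM => //.
  by apply: measurable_funTS; exact: measurable_powR.
- apply: (eq_measurable_fun (fun x => rho * (k x * h (x `^ rho - t `^ rho)))).
    by move=> x /set_mem/E.
  apply: measurable_funM => //; apply: measurable_funM => //.
  apply: (measurable_comp _ _ mh mphi) => //.
  by move=> _ [x /= xat <-]; rewrite -phiE phiS.
Qed.

End KatugampolaKernels.

(** * Iterating a power-weighted derivative *)

Section PowerWeightedDerivatives.
Context {R : realType}.
Implicit Types (a b t sg rho : R) (x : nat -> R -> R).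

(** Applying [sg t^(1-rho) d/dt] to [t^(j - k rho) x^(j)] gives a multiple of
[t^(j - (k+1) rho) x^(j)] and one term [t^(j+1 - (k+1) rho) x^(j+1)].  The
coefficients follow the resulting triangular recursion. *)
Fixpoint euler_coef sg rho k j : R :=
  if k is k'.+1 then
    sg * ((j%:R - k'%:R * rho) * euler_coef sg rho k' j +
          if j is i.+1 then euler_coef sg rho k' i else 0)
  else (j == 0%N)%:R.

Definition euler_sum sg rho x k t : R :=
  \sum_(j < k.+1) euler_coef sg rho k j * t `^ (j%:R - k%:R * rho) * x j t.

Lemma euler_coef_gt sg rho k j : (k < j)%N -> euler_coef sg rho k j = 0.
Proof.
elim: k j => [|k IHk] [|j]//= kj.
by rewrite IHk ?(ltnW kj)// IHk// mulr0 addr0 mulr0.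
Qed.

(** Splitting the recursion of the coefficients yields two sums over
[j < k + 2]: the last term of the first and the first term of the second
vanish, and what remains is the product rule term by term. *)
Lemma euler_sum_chain a b sg rho n x : 0 < a ->
  op_chain a b (fun=> 1) n x ->
  op_chain a b (fun t => sg * t `^ (1 - rho)) n (euler_sum sg rho x).
Proof.
move=> a0 xch k t kn tab.
have t0 : 0 < t by move: tab; rewrite in_itv/= => /andP[/(lt_le_trans a0)].
pose q j : R := j%:R - k%:R * rho.
exists (\sum_(j < k.+1) (euler_coef sg rho k j * (q j * t `^ (q j - 1)) * x j t
    + euler_coef sg rho k j * t `^ q j * x j.+1 t)).
  apply: (@is_deriv_on_sum _ a b k.+1 (fun j y =>
    euler_coef sg rho k j * y `^ q j * x j y) t (fun j =>
    euler_coef sg rho k j * (q j * t `^ (q j - 1)) * x j t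
    + euler_coef sg rho k j * t `^ q j * x j.+1 t)) => j jk.
  apply: is_deriv_onM.
    by apply: is_deriv_onZ; apply: is_derive_on; exact: is_derive1_powR.
  have [|l xl ->] := xch j t _ tab; last by rewrite mul1r.
  exact: leq_trans kn.
rewrite /euler_sum /= mulr_sumr.
have pD p r : t `^ p * t `^ r = t `^ (p + r).
  by rewrite powRD//; apply/implyP => _; rewrite gt_eqF.
under eq_bigr do rewrite mulrDr 2!mulrDl.
rewrite big_split/= big_ord_recr/= euler_coef_gt// mulr0 mulr0 !mul0r addr0.
rewrite [X in _ + X]big_ord_recl/= mulr0 !mul0r add0r -big_split/=.
apply: eq_bigr => j _; rewrite mulrDr; congr (_ + _).
  have -> : t `^ (j%:R - k.+1%:R * rho) = t `^ (1 - rho) * t `^ (q j - 1).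
    by rewrite pD; congr (_ `^ _); rewrite /q -natr1; ring.
  by rewrite /q; ring.
have -> : t `^ ((bump 0 j)%:R - k.+1%:R * rho) = t `^ (1 - rho) * t `^ q j.
  by rewrite pD; congr (_ `^ _); rewrite /q /bump/= natrD -natr1; ring.
by ring.
Qed.

Lemma euler_sum_continuous a b sg rho n x : 0 < a ->
  op_chain a b (fun=> 1) n x -> {within `[a, b], continuous (x n)} ->
  {within `[a, b], continuous (euler_sum sg rho x n)}.
Proof.
move=> a0 xch cxn.
have cx j : (j <= n)%N -> {within `[a, b], continuous (x j)}.
  rewrite leq_eqVlt => /predU1P[->//|jn].
  apply: is_deriv_on_continuous => t tab.
  by have [l xl _] := xch j t jn tab; exists l.
have cp p : {within `[a, b], continuous (fun t : R => t `^ p)}.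
  apply: derivable_within_continuous => t; rewrite in_itv/= => /andP[at_ _].
  by apply: derivable_powR; rewrite in_itv/= andbT (lt_le_trans a0).
move=> t; rewrite /euler_sum.
apply: cvg_big => [|j _]; first exact: add_continuous.
apply: cvgM; last by apply: cx; rewrite -ltnS.
by apply: cvgM; [exact: cvg_cst|exact: cp].
Qed.

End PowerWeightedDerivatives.

(** * Continuity and linearity on a segment *)

Section Segments.
Context {R : realType}.
Implicit Types (a b A B e s t u : R) (f F : R -> R).
Notation mu := (@lebesgue_measure R).

Lemma within_continuous_comp A B a b f phi :
  {within `[A, B], continuous f} -> {within `[a, b], continuous phi} ->
  {in `[a, b], forall t, phi t \in `[A, B]} ->
  {within `[a, b], continuous (f \o phi)}.
Proof.
move=> /subspace_continuousP cf /subspace_continuousP cphi phiAB.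
apply/subspace_continuousP => t tab.
apply: cvg_comp (cf _ (phiAB _ tab)) => P.
move=> /(cphi _ tab) phiP.
have : nbhs (t : R) (fun y : R => y \in `[a, b] ->
  phi y \in `[A, B] -> P (phi y)) by exact: phiP.
suff imp : forall y : R, (y \in `[a, b] -> phi y \in `[A, B] -> P (phi y)) ->
    (y \in `[a, b] -> P (phi y)) by move/(filterS imp).
by move=> y h yab; exact: h yab (phiAB _ yab).
Qed.

Lemma eq_within_continuous a b f F : {in `[a, b], f =1 F} ->
  {within `[a, b], continuous f} -> {within `[a, b], continuous F}.
Proof.
move=> fF; apply: subspace_eq_continuous => x; rewrite inE/= => xab.
exact: fF.
Qed.

Lemma reflect_continuous A B s F : s \in `[A, B] ->
  {within `[A, B], continuous F} ->
  {within `[0, s - A], continuous (fun v => F (s - v))}.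
Proof.
move=> sAB cF; apply: (within_continuous_comp cF).
  apply: derivable_within_continuous => v _.
  exact: derivableB.
move: sAB; rewrite in_itv/= => /andP[As sB] v.
rewrite !in_itv/= => /andP[v0 vs].
by apply/andP; split; lra.
Qed.

Lemma eq_riemann_liouville A B e F G s : s \in `[A, B] ->
  {in `[A, B], F =1 G} -> riemann_liouville A e F s = riemann_liouville A e G s.
Proof.
move=> sAB FG; apply: eq_Rintegral => v; rewrite inE/= in_itv/= => /andP[v0 vs].
rewrite FG//; move: sAB; rewrite !in_itv/= => /andP[? ?].
by apply/andP; split; lra.
Qed.

Lemma riemann_liouvilleZ A B e c F s : 0 < e + 1 -> s \in `[A, B] ->
  {within `[A, B], continuous F} ->
  riemann_liouville A e (fun u => c * F u) s = c * riemann_liouville A e F s.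
Proof.
move=> e1 sAB cF; have cFs := reflect_continuous sAB cF.
have [M M0 hM] := within_continuous_bounded cFs.
rewrite /riemann_liouville -RintegralZl//.
  by apply: eq_Rintegral => v _; rewrite mulrCA.
apply: (@integrable_kernelM _ _ (fun v : R => v `^ e) (fun v => F (s - v)) M)
  => //.
- exact: powR_integrable.
- exact: subspace_continuous_measurable_fun.
Qed.

End Segments.

(** * Transport along a signed power *)

Section Transport.
Context {R : realType}.
(** [sg] is 1 in the left case and -1 in the right case; the sign makes
[sg * t^rho] increase away from the base point in both cases. *)
Variables (sg rho a b A B : R).
Hypotheses (a_gt0 : 0 < a) (ltab : a < b) (rho_gt0 : 0 < rho).
Hypothesis sg2 : sg * sg = 1.

Definition signed_pow (t : R) : R := sg * t `^ rho.
Definition signed_root (u : R) : R := (sg * u) `^ rho^-1.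

Hypothesis pow_itv : {in `[a, b], forall t, signed_pow t \in `[A, B]}.
Hypothesis pow_onto : {in `[A, B], forall u,
  exists2 t, t \in `[a, b] & u = signed_pow t}.
Notation psi := signed_pow.
Notation eta := signed_root.
Notation w := (fun t => sg * t `^ (1 - rho)).

Let pos t : t \in `[a, b] -> 0 < t.
Proof. by rewrite in_itv/= => /andP[/(lt_le_trans a_gt0)]. Qed.

Let sgK u : sg * (sg * u) = u.
Proof. by rewrite mulrA sg2 mul1r. Qed.

Let rho_neq0 : rho != 0.
Proof. by rewrite gt_eqF. Qed.

Lemma signed_powK : {in `[a, b], cancel psi eta}.
Proof.
move=> t /pos t0; rewrite /eta /psi sgK -powRrM mulfV// powRr1//.
exact: ltW.
Qed.

Lemma signed_rootK : {in `[A, B], cancel eta psi}.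
Proof. by move=> u /pow_onto[t tab ->]; rewrite signed_powK. Qed.

Lemma signed_root_itv : {in `[A, B], forall u, eta u \in `[a, b]}.
Proof. by move=> u /pow_onto[t tab ->]; rewrite signed_powK. Qed.

Lemma signed_pow_itv_lt : A < B.
Proof.
have ain : a \in `[a, b] by rewrite in_itv/= lexx ltW.
have bin : b \in `[a, b] by rewrite in_itv/= lexx ltW.
have := pow_itv ain; have := pow_itv bin; rewrite !in_itv/=.
move=> /andP[Ab bB] /andP[Aa aB].
rewrite ltNge; apply/negP => BA.
have : psi a = psi b by apply/eqP; rewrite eq_le; apply/andP; split; lra.
move=> /(congr1 eta); rewrite !signed_powK// => ab.
by move: ltab; rewrite ab ltxx.
Qed.

Lemma signed_pow_deriv t : t \in `[a, b] ->
  is_deriv_on a b psi t (sg * (rho * t `^ (rho - 1))).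
Proof.
move=> /pos t0; apply: is_derive_on.
have := is_derive_powR_affine sg rho 0 t0.
by under eq_fun do rewrite addr0.
Qed.

Lemma signed_root_deriv t : t \in `[a, b] ->
  is_deriv_on A B eta (psi t) (rho^-1 * w t).
Proof.
move=> /pos t0; apply: is_derive_on.
have su : 0 < sg * psi t by rewrite /psi sgK powR_gt0.
have d1 : is_derive (psi t) 1 ( *%R sg) sg.
  have -> : *%R sg = sg \*: (@id R) by apply/funext.
  by apply: is_derive_eq; rewrite /GRing.scale/= mulr1.
have d2 := is_derive1_powR rho^-1 su.
have d3 := @is_derive1_comp _ (fun y : R => y `^ rho^-1) ( *%R sg) _ _ _ d2 d1.
apply: is_derive_eq d3 _.
rewrite /psi sgK -powRrM -mulrA [_ * sg]mulrC; congr (_ * (_ * _ `^ _)).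
by rewrite mulrBr mulr1 mulfV.
Qed.

(** The operator [w d/dt] becomes [rho d/du]; the factor [rho ^- k] turns its
iterates into plain derivatives in [u]. *)
Let conj_chain (d : nat -> R -> R) k u : R := rho ^- k * d k (eta u).

Lemma conj_chainP n d : op_chain a b w n d ->
  op_chain A B (fun=> 1) n (conj_chain d).
Proof.
move=> dch k u kn uAB; have [t tab uE] := pow_onto uAB; subst u.
have [l dl dE] := dch k t kn tab.
exists (rho ^- k * (l * (rho^-1 * w t))).
  apply: is_deriv_onZ.
  apply: (@is_deriv_on_comp _ A B a b eta (d k)) => //.
  - exact: signed_root_itv.
  - by move=> y z yAB zAB /(congr1 psi); rewrite !signed_rootK.
  - exact: signed_root_deriv.
  - by rewrite signed_powK.
rewrite mul1r /conj_chain signed_powK// dE exprS invfM; ring.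
Qed.

Lemma signed_root_continuous : {within `[A, B], continuous eta}.
Proof.
apply: is_deriv_on_continuous => u /pow_onto[t tab ->].
by exists (rho^-1 * w t); exact: signed_root_deriv.
Qed.

Lemma signed_pow_continuous : {within `[a, b], continuous psi}.
Proof.
apply: is_deriv_on_continuous => t tab.
by exists (sg * (rho * t `^ (rho - 1))); exact: signed_pow_deriv.
Qed.

Lemma conj_chain_continuous n d : {within `[a, b], continuous (d n)} ->
  {within `[A, B], continuous (conj_chain d n)}.
Proof.
move=> cd; have cde := within_continuous_comp cd signed_root_continuous
  signed_root_itv.
by move=> u; apply: cvgM; [exact: cvg_cst|exact: cde].
Qed.

Lemma pow_deriv_chain n (Y : nat -> R -> R) : op_chain A B (fun=> 1) n Y ->
  op_chain a b w n (fun k t => rho^-1 * rho ^+ k * Y k (psi t)).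
Proof.
move=> Ych k t kn tab; have [l Yl YE] := Ych k _ kn (pow_itv tab).
exists (rho^-1 * rho ^+ k * (l * (sg * (rho * t `^ (rho - 1))))).
  apply: is_deriv_onZ.
  apply: (@is_deriv_on_comp _ a b A B psi (Y k)) => //.
  - by move=> y z yAB zAB /(congr1 eta); rewrite !signed_powK.
  - exact: signed_pow_deriv.
have pp : t `^ (1 - rho) * t `^ (rho - 1) = 1.
  rewrite -powRD ?addrA ?subrK ?subrr ?powRr0//.
  by apply/implyP => _; rewrite gt_eqF// pos.
rewrite YE mul1r exprS.
(* The weight and the derivative of [psi] multiply to [rho]. *)
transitivity ((sg * sg) * (t `^ (1 - rho) * t `^ (rho - 1)) *
  (rho^-1 * (rho * rho ^+ k) * l)); last by ring.
by rewrite sg2 pp !mul1r.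
Qed.

Definition remainder_at (n : nat) (d : nat -> R -> R) (c t : R) : R :=
  d 0%N t - \sum_(k < n) rho ^- k / k`!%:R * (psi t - psi c) ^+ k * d k c.

(** [J] is the fractional integral of one of the two sides, given by its
expression in the variable [u].  The remainder at [c] read in [u] is the Taylor
remainder at [A], so the chain of its Riemann-Liouville integrals, transported
back to [t], computes the iterates of [D] on [J (remainder)]; its last member
is [J (d n)] because the n-th Taylor remainder has no polynomial left. *)
Theorem remainder_transport n d e c (J D : (R -> R) -> R -> R) :
  0 < e + 1 -> c \in `[a, b] -> psi c = A ->
  (forall f t, D f t = w t * deriv_on a b f t) ->
  (forall f, {within `[a, b], continuous f} -> {in `[a, b], forall t,
    J f t = rho^-1 * riemann_liouville A e (f \o eta) (psi t)}) ->
  op_chain a b w n d -> {within `[a, b], continuous (d n)} ->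
  [/\ {within `[a, b], continuous (remainder_at n d c)},
      iter_derivable a b D n (J (remainder_at n d c))
    & {in `[a, b], forall t,
        J (d n) t = iter n D (J (remainder_at n d c)) t}].
Proof.
move=> e1 cab cA DE JE dch cd; set r := remainder_at n d c.
set X := conj_chain d; have Xch := conj_chainP dch.
have cX : {within `[A, B], continuous (X n)} by exact: conj_chain_continuous.
have rE : {in `[a, b], r =1 taylor_rem A n X 0 \o psi}.
  move=> t tab; rewrite /r /remainder_at /taylor_rem /= subn0 /X /conj_chain.
  rewrite signed_powK// expr0 invr1 mul1r; congr (_ - _).
  apply: eq_bigr => k _; rewrite add0n -cA signed_powK//; ring.
have cr : {within `[a, b], continuous r}.
  apply: (@eq_within_continuous _ _ _ (taylor_rem A n X 0 \o psi)).
    by move=> t tab; rewrite rE.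
  apply: within_continuous_comp pow_itv; last exact: signed_pow_continuous.
  exact: taylor_rem_continuous.
have Ych := pow_deriv_chain
  (riemann_liouville_taylor_rem signed_pow_itv_lt e1 Xch cX).
have Jr : {in `[a, b], J r =1 fun t =>
    rho^-1 * rho ^+ 0 * riemann_liouville A e (taylor_rem A n X 0) (psi t)}.
  move=> t tab; rewrite JE// expr0 mulr1; congr (_ * _).
  apply: (@eq_riemann_liouville _ A B); first exact: pow_itv.
  by move=> u uAB /=; rewrite rE ?signed_root_itv//= signed_rootK.
have [JD JDE] := op_chain_iter ltab DE Ych Jr.
split=> // t tab; rewrite JDE// JE// -mulrA; congr (_ * _).
rewrite -(@riemann_liouvilleZ _ A B) ?pow_itv//; last first.
  exact: taylor_rem_continuous.
apply: (@eq_riemann_liouville _ A B); first exact: pow_itv.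
move=> u uAB; rewrite taylor_rem_top /X /conj_chain /= mulrA mulfV ?mul1r//.
by rewrite expf_neq0.
Qed.

End Transport.

(** * The left and right identities *)

Section CnIter.
Context {R : realType}.
Implicit Types (a b sg rho alpha t : R) (n : nat) (x f : R -> R).
Notation mu := (@lebesgue_measure R).

(** Being n times continuously differentiable does not depend on whether one
differentiates with [d/dt] or with [sg t^(1-rho) d/dt], as [a > 0] keeps the
powers of [t] smooth on [a, b]. *)
Lemma Cn_on_iter a b sg rho n x (D : (R -> R) -> R -> R) :
  0 < a -> a < b ->
  (forall f t, D f t = sg * t `^ (1 - rho) * deriv_on a b f t) ->
  Cn_on a b n x ->
  iter_derivable a b D n x /\ {within `[a, b], continuous (iter n D x)}.
Proof.
move=> a0 ab DE [xD cx].
have xch : op_chain a b (fun=> 1) n (fun k => iter k (deriv_on a b) x).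
  by apply: iter_op_chain xD => h t; rewrite mul1r.
have [|xD' DxE] := op_chain_iter (f := x) ab DE (euler_sum_chain sg rho a0 xch).
  by move=> t tab; rewrite /euler_sum big_ord1/= mul0r subr0 powRr0 !mul1r.
split=> //; apply: (@eq_within_continuous _ _ _
    (euler_sum sg rho (fun k => iter k (deriv_on a b) x) n)).
  by move=> t tab; rewrite DxE.
exact: euler_sum_continuous.
Qed.

Lemma powR_itv a b rho : 0 < a -> 0 < rho ->
  {in `[a, b], forall t, t `^ rho \in `[a `^ rho, b `^ rho]}.
Proof.
move=> a0 rho0 t; rewrite !in_itv/= => /andP[at_ tb].
have t0 := lt_le_trans a0 at_.
by rewrite !ge0_ler_powR ?nnegrE ?(ltW t0) ?(ltW a0) ?(ltW rho0)//
  (le_trans (ltW t0)).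
Qed.

Lemma powR_onto a b rho : 0 < a -> 0 < b -> 0 < rho ->
  {in `[a `^ rho, b `^ rho], forall u, exists2 t, t \in `[a, b] & u = t `^ rho}.
Proof.
move=> a0 b0 rho0 u; rewrite in_itv/= => /andP[au ub].
have u0 : 0 < u by rewrite (lt_le_trans _ au)// powR_gt0.
have root y : 0 < y -> (y `^ rho) `^ rho^-1 = y.
  by move=> y0; rewrite -powRrM mulfV ?gt_eqF// powRr1// ltW.
have rho'0 : 0 <= rho^-1 by rewrite invr_ge0 ltW.
exists (u `^ rho^-1); last by rewrite -powRrM mulVf ?gt_eqF// powRr1// ltW.
rewrite in_itv/= -[X in X <= _](root a)// -[X in _ && (_ <= X)](root b)//.
by rewrite !ge0_ler_powR ?nnegrE ?powR_ge0 ?(ltW u0).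
Qed.

End CnIter.

Section Left.
Context {R : realType}.
Variables (a b rho alpha : R) (n : nat).
Hypotheses (a_gt0 : 0 < a) (ltab : a < b) (rho_gt0 : 0 < rho).
Hypothesis e1 : 0 < n%:R - alpha - 1 + 1.
Notation mu := (@lebesgue_measure R).
Notation e := (n%:R - alpha - 1).

Let b_gt0 : 0 < b. Proof. exact: lt_trans ltab. Qed.

Lemma left_pow_itv : {in `[a, b], forall t,
  signed_pow 1 rho t \in `[signed_pow 1 rho a, signed_pow 1 rho b]}.
Proof. by move=> t tab; rewrite /signed_pow !mul1r; exact: powR_itv. Qed.

Lemma left_pow_onto : {in `[signed_pow 1 rho a, signed_pow 1 rho b], forall u,
  exists2 t, t \in `[a, b] & u = signed_pow 1 rho t}.
Proof.
move=> u; rewrite /signed_pow !mul1r => /(powR_onto a_gt0 b_gt0 rho_gt0).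
by move=> [t tab ->]; exists t; rewrite ?mul1r.
Qed.

Lemma kint_leftP f t : {within `[a, b], continuous f} -> t \in `[a, b] ->
  mu.-integrable `[a, t] (fun tau =>
    (kernel_left rho alpha n t tau * f tau)%:E) /\
  kint_left a rho alpha n f t = rho^-1 *
    riemann_liouville (signed_pow 1 rho a) e (f \o signed_root 1 rho)
      (signed_pow 1 rho t).
Proof.
move=> cf tab.
have ss : 1 * 1 = 1 :> R by rewrite mulr1.
have cF := within_continuous_comp cf
  (signed_root_continuous a_gt0 rho_gt0 ss left_pow_onto)
  (signed_root_itv a_gt0 rho_gt0 ss left_pow_onto).
have := reflect_continuous (left_pow_itv tab) cF.
(* [f] at the point whose distance from [t], in the variable [u], is [v]. *)
pose h v := (f \o signed_root 1 rho) (signed_pow 1 rho t - v).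
have sE : signed_pow 1 rho t - signed_pow 1 rho a = t `^ rho - a `^ rho.
  by rewrite /signed_pow !mul1r.
rewrite sE -/h => ch.
have at_ : a <= t by move: tab; rewrite in_itv/= => /andP[].
have [] := left_substitution a_gt0 at_ rho_gt0 e1 ch.
have hE : {in `[a, t], forall tau, h (t `^ rho - tau `^ rho) = f tau}.
  move=> tau; rewrite in_itv/= => /andP[atau taut].
  rewrite /h /= /signed_pow mul1r subKr -[tau `^ rho]mul1r.
  rewrite (signed_powK (a := a) (b := b))// in_itv/= atau (le_trans taut)//.
  by move: tab; rewrite in_itv/= => /andP[].
move=> ih Eh; split.
  by apply: eq_integrable ih => // tau /set_mem/hE ->.
rewrite /kint_left.
transitivity (\int[mu]_(x in `[a, t]) (x `^ (rho - 1) *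
    (t `^ rho - x `^ rho) `^ e * h (t `^ rho - x `^ rho))).
  by apply: eq_Rintegral => tau /set_mem/hE ->.
by rewrite Eh /riemann_liouville sE.
Qed.

Theorem caputo_left_katugampola x : Cn_on a b n x ->
  [/\ caputo_left_defined a b rho alpha n x,
      katugampola_left_defined a b rho alpha n (remainder_left a b rho n x)
    & forall t, t \in `[a, b] ->
        caputo_left a b rho alpha n x t =
        katugampola_left a b rho alpha n (remainder_left a b rho n x) t].
Proof.
move=> xCn; have ss : 1 * 1 = 1 :> R by rewrite mulr1.
have DE f t : kdiff_left a b rho f t = 1 * t `^ (1 - rho) * deriv_on a b f t.
  by rewrite mul1r.
have [xD cx] := Cn_on_iter a_gt0 ltab DE xCn.
have ain : a \in `[a, b] by rewrite in_itv/= lexx ltW.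
have [cr JrD JrE] := remainder_transport a_gt0 ltab rho_gt0 ss left_pow_itv
  left_pow_onto e1 ain erefl DE (fun f cf t tab => (kint_leftP cf tab).2)
  (iter_op_chain DE xD) cx.
have rE : remainder_left a b rho n x =
    remainder_at 1 rho n (fun k => iter k (kdiff_left a b rho) x) a.
  by apply/funext => t; rewrite /remainder_at /signed_pow !mul1r.
rewrite rE; split.
- by split=> // t tab; exact: (kint_leftP cx tab).1.
- by split=> // t tab; exact: (kint_leftP cr tab).1.
- by move=> t tab; rewrite /katugampola_left -JrE.
Qed.

End Left.

Section Right.
Context {R : realType}.
Variables (a b rho alpha : R) (n : nat).
Hypotheses (a_gt0 : 0 < a) (ltab : a < b) (rho_gt0 : 0 < rho).
Hypothesis e1 : 0 < n%:R - alpha - 1 + 1.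
Notation mu := (@lebesgue_measure R).
Notation e := (n%:R - alpha - 1).

Let b_gt0 : 0 < b. Proof. exact: lt_trans ltab. Qed.

Lemma right_pow_itv : {in `[a, b], forall t,
  signed_pow (-1) rho t \in `[signed_pow (-1) rho b, signed_pow (-1) rho a]}.
Proof.
move=> t /(powR_itv a_gt0 rho_gt0).
by rewrite /signed_pow !mulN1r !in_itv/= !lerN2 andbC.
Qed.

Lemma right_pow_onto : {in `[signed_pow (-1) rho b, signed_pow (-1) rho a],
  forall u, exists2 t, t \in `[a, b] & u = signed_pow (-1) rho t}.
Proof.
move=> u uAB; have : - u \in `[a `^ rho, b `^ rho].
  by move: uAB; rewrite /signed_pow !mulN1r !in_itv/= lerNl lerNr andbC.
move=> /(powR_onto a_gt0 b_gt0 rho_gt0)[t tab ut].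
by exists t => //; rewrite /signed_pow mulN1r -ut opprK.
Qed.

Lemma kint_rightP f t : {within `[a, b], continuous f} -> t \in `[a, b] ->
  mu.-integrable `[t, b] (fun tau =>
    (kernel_right rho alpha n t tau * f tau)%:E) /\
  kint_right b rho alpha n f t = rho^-1 *
    riemann_liouville (signed_pow (-1) rho b) e (f \o signed_root (-1) rho)
      (signed_pow (-1) rho t).
Proof.
move=> cf tab.
have ss : -1 * -1 = 1 :> R by rewrite mulrNN mulr1.
have cF := within_continuous_comp cf
  (signed_root_continuous a_gt0 rho_gt0 ss right_pow_onto)
  (signed_root_itv a_gt0 rho_gt0 ss right_pow_onto).
have := reflect_continuous (right_pow_itv tab) cF.
(* [f] at the point whose distance from [t], in the variable [u], is [v]. *)
pose h v := (f \o signed_root (-1) rho) (signed_pow (-1) rho t - v).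
have sE : signed_pow (-1) rho t - signed_pow (-1) rho b = b `^ rho - t `^ rho.
  by rewrite /signed_pow !mulN1r opprK addrC.
rewrite sE -/h => ch.
have tb : t <= b by move: tab; rewrite in_itv/= => /andP[].
have t0 : 0 < t by move: tab; rewrite in_itv/= => /andP[/(lt_le_trans a_gt0)].
have [] := right_substitution t0 tb rho_gt0 e1 ch.
have hE : {in `[t, b], forall tau, h (tau `^ rho - t `^ rho) = f tau}.
  move=> tau; rewrite in_itv/= => /andP[ttau taub].
  have -> : h (tau `^ rho - t `^ rho) =
      f (signed_root (-1) rho (signed_pow (-1) rho tau)).
    rewrite /h /=; congr (f (signed_root _ _ _)); rewrite /signed_pow; ring.
  rewrite (signed_powK (a := a) (b := b))// in_itv/= taub andbT.
  rewrite (le_trans _ ttau)//.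
  by move: tab; rewrite in_itv/= => /andP[].
move=> ih Eh; split.
  by apply: eq_integrable ih => // tau /set_mem/hE ->.
rewrite /kint_right.
transitivity (\int[mu]_(x in `[t, b]) (x `^ (rho - 1) *
    (x `^ rho - t `^ rho) `^ e * h (x `^ rho - t `^ rho))).
  by apply: eq_Rintegral => tau /set_mem/hE ->.
by rewrite Eh /riemann_liouville sE.
Qed.

(** Beyond the left case, the signs have to be matched: the remainder is written
with the unsigned operator and an explicit (-1)^k, while the transport uses the
iterates of the signed operator. *)
Theorem caputo_right_katugampola x : Cn_on a b n x ->
  [/\ caputo_right_defined a b rho alpha n x,
      katugampola_right_defined a b rho alpha n (remainder_right a b rho n x)
    & forall t, t \in `[a, b] ->
        caputo_right a b rho alpha n x t =
        katugampola_right a b rho alpha n (remainder_right a b rho n x) t].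
Proof.
move=> xCn; have ss : -1 * -1 = 1 :> R by rewrite mulrNN mulr1.
have DE f t : kdiff_right a b rho f t = -1 * t `^ (1 - rho) * deriv_on a b f t.
  by rewrite mulN1r.
have [xD cx] := Cn_on_iter a_gt0 ltab DE xCn.
have bin : b \in `[a, b] by rewrite in_itv/= lexx ltW.
have [cr JrD JrE] := remainder_transport a_gt0 ltab rho_gt0 ss right_pow_itv
  right_pow_onto e1 bin erefl DE (fun f cf t tab => (kint_rightP cf tab).2)
  (iter_op_chain DE xD) cx.
have DlE f t : kdiff_left a b rho f t = 1 * t `^ (1 - rho) * deriv_on a b f t.
  by rewrite mul1r.
have [xDl _] := Cn_on_iter a_gt0 ltab DlE xCn.
have rlch : op_chain a b (fun t => -1 * t `^ (1 - rho)) n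
    (fun k t => (-1) ^+ k * iter k (kdiff_left a b rho) x t).
  move=> k t kn tab; have [l xl lE] := iter_op_chain DlE xDl kn tab.
  exists ((-1) ^+ k * l); first exact: is_deriv_onZ.
  rewrite lE exprS; ring.
have [_ rlE] := op_chain_iter (f := x) ltab DE rlch
  (fun t _ => esym (mul1r (x t))).
have rE : remainder_right a b rho n x =
    remainder_at (-1) rho n (fun k => iter k (kdiff_right a b rho) x) b.
  apply/funext => t; rewrite /remainder_right /remainder_at; congr (_ - _).
  apply: eq_bigr => k _; rewrite (rlE k (ltnW (ltn_ord k)) b bin).
  have -> : signed_pow (-1) rho t - signed_pow (-1) rho b = b `^ rho - t `^ rho.
    by rewrite /signed_pow !mulN1r opprK addrC.
  move: (iter _ _ _ _) ((b `^ rho - _) ^+ _) => y p.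
  by move: (rho ^- k) ((-1) ^+ k) (k`!%:R^-1) => q s f; ring.
rewrite rE; split.
- by split=> // t tab; exact: (kint_rightP cx tab).1.
- by split=> // t tab; exact: (kint_rightP cr tab).1.
- by move=> t tab; rewrite /katugampola_right -JrE.
Qed.

End Right.

Theorem theorem6 (R : realType) (a b rho alpha : R) (n : nat) (x : R -> R)
    (a_gt0 : 0 < a) (ltab : a < b) (rho_gt0 : 0 < rho) (alpha_gt0 : 0 < alpha)
    (alpha_n : n%:R - 1 < alpha < n%:R) (xCn : Cn_on a b n x) :
  [/\ caputo_left_defined a b rho alpha n x,
      katugampola_left_defined a b rho alpha n (remainder_left a b rho n x)
    & forall t, t \in `[a, b] ->
        caputo_left a b rho alpha n x t =
        katugampola_left a b rho alpha n (remainder_left a b rho n x) t] /\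
  [/\ caputo_right_defined a b rho alpha n x,
      katugampola_right_defined a b rho alpha n (remainder_right a b rho n x)
    & forall t, t \in `[a, b] ->
        caputo_right a b rho alpha n x t =
        katugampola_right a b rho alpha n (remainder_right a b rho n x) t].
Proof.
have e1 : 0 < n%:R - alpha - 1 + 1.
  by rewrite subrK subr_gt0; case/andP: alpha_n.
by split; [exact: caputo_left_katugampola|exact: caputo_right_katugampola].
Qed.
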